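(* Let $f:\mathrm{dom}(f)\to\mathbb{R}$ be a self-concordant function (see context) with minimizer $x_*$. Consider the DFP and BFGS methods (see context) with initial point $x_0\in\mathrm{dom}(f)$ and symmetric positive-definite initial Hessian approximation $B_0$. Suppose that for DFP $$\|\nabla^{2}f(x_* )^\frac{1}{2}(x_0 - x_* )\| \leq \frac{1}{720}, \qquad \|\nabla^{2}f(x_* )^{-\frac{1}{2}} (B_0 - \nabla^{2}f(x_* ))\nabla^{2}f(x_* )^{-\frac{1}{2}}\|_F \leq \frac{1}{7},$$ and that for BFGS $$\|\nabla^{2}f(x_* )^\frac{1}{2}(x_0 - x_* )\| \leq \frac{1}{300}, \qquad \|\nabla^{2}f(x_* )^{-\frac{1}{2}} (B_0 - \nabla^{2}f(x_* ))\nabla^{2}f(x_* )^{-\frac{1}{2}}\|_F \leq \frac{1}{7}.$$ Then the iterates $\{x_k\}_{k\ge0}$ generated by the DFP method, respectively the BFGS method, satisfy for all $k\ge1$ $$\frac{\|\nabla^2 f(x_* )^{\frac{1}{2}}(x_k - x_* )\|}{\|\nabla^2 f(x_* )^{\frac{1}{2}}(x_0 - x_* )\|} \leq \left(\frac{1}{k}\right)^{\frac{k}{2}}, \qquad \frac{f(x_k) - f(x_* )}{f(x_0) - f(x_* )} \leq 1.1\left(\frac{1}{k}\right)^{k}.$$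
   Context: Self-concordant function: $f:\mathrm{dom}(f)\to\mathbb{R}$ with $\mathrm{dom}(f)\subseteq\mathbb{R}^d$ open and convex and $f$ closed (closed epigraph; automatic when $\mathrm{dom}(f)=\mathbb{R}^d$), such that (i) $f$ is three times continuously differentiable, (ii) $\nabla^2 f(x)\succ0$ for all $x\in\mathrm{dom}(f)$, and (iii) $\left.\frac{d}{dt}\nabla^2 f(x+ty)\right|_{t=0}\preceq 2\left(y^\top\nabla^2 f(x)y\right)^{1/2}\nabla^2 f(x)$ for all $x\in\mathrm{dom}(f)$, $y\in\mathbb{R}^d$. Here $A\preceq B$ means $B-A$ is symmetric positive semidefinite. $f$ is assumed to have a minimizer $x_*$, which is then unique. DFP and BFGS methods (unit step size): given $x_0$ and a symmetric positive-definite $B_0\in\mathbb{R}^{d\times d}$, for $k=0,1,2,\dots$ set $x_{k+1}=x_k-B_k^{-1}\nabla f(x_k)$, $s_k=x_{k+1}-x_k$, $y_k=\nabla f(x_{k+1})-\nabla f(x_k)$, and $B_{k+1}=B^{DFP}_{k+1}$ (DFP method) or $B_{k+1}=B^{BFGS}_{k+1}$ (BFGS method), where $$B^{DFP}_{k+1} = \left(I-\frac{y_k s_k^\top}{y_k^\top s_k}\right) B_k \left(I-\frac{ s_ky_k^\top}{s_k^\top y_k}\right) +\frac{y_k y_k^\top}{y_k^\top s_k},\qquad B^{BFGS}_{k+1} = B_k - \frac{B_k s_k s_k^\top B_k}{s_k^\top B_k s_k} + \frac{y_k y_k^\top}{s_k^\top y_k}.$$ The algorithm terminates if $s_k=0$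 (in which case $x_k=x_*$); it is assumed throughout that $s_k\ne0$ for all $k$. Then $s_k^\top y_k>0$ and all $B_k$ are symmetric positive-definite. $\|\cdot\|$ is the Euclidean norm of vectors and the induced 2-norm of matrices, $\|\cdot\|_F$ is the Frobenius norm, and $A^{1/2},A^{-1/2}$ denote the symmetric positive-definite square roots of $A$ and $A^{-1}$. *)

(* Defs.v *)
From HB Require Import structures.
From mathcomp Require Import all_boot all_order all_algebra.
From mathcomp Require Import all_classical all_reals all_analysis.
Set Implicit Arguments.
Unset Strict Implicit.
Unset Printing Implicit Defensive.
Import Order.TTheory GRing.Theory Num.Theory.
Import numFieldNormedType.Exports.
Local Open Scope classical_set_scope.
Local Open Scope ring_scope.

Section Matrices.
Context {R : realType} {d : nat}.
Implicit Types (A B S : 'M[R]_d) (u v x : 'cV[R]_d).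

Definition dotcv u v : R := (u^T *m v) 0 0.

(* The library norm on matrices is the max norm, hence the explicit norms. *)
Definition norm2 u : R := Num.sqrt (\sum_i u i 0 ^+ 2).
Definition normF A : R := Num.sqrt (\sum_i \sum_j A i j ^+ 2).

Definition possemidefmx A : Prop := A^T = A /\ forall v, 0 <= dotcv v (A *m v).
Definition posdefmx A : Prop :=
  A^T = A /\ forall v, v != 0 -> 0 < dotcv v (A *m v).
Definition loewner_le A B : Prop := possemidefmx (B - A).

(* For A symmetric positive definite there is exactly one such S; the value is
   0 when there is none. *)
Definition sqrtmx A : 'M[R]_d := xget 0 [set S | posdefmx S /\ S *m S = A].

End Matrices.

Section SelfConcordance.
Context {R : realType} {d : nat}.
Implicit Types (D : set 'cV[R]_d) (f : 'cV[R]_d -> R) (x y : 'cV[R]_d).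

Definition grad f x : 'cV[R]_d := \col_i 'D_(delta_mx i 0) f x.
Definition hess f x : 'M[R]_d :=
  \matrix_(i, j) 'D_(delta_mx i 0) ('D_(delta_mx j 0) f) x.

(* f is n times continuously differentiable on the open set D. In finite
   dimension the differential is C^n as soon as all the maps x |-> 'd f x v
   = 'D_v f x are. *)
Fixpoint Cn (n : nat) D f : Prop :=
  if n is m.+1 then
    {in D, forall x, differentiable f x} /\ forall v, Cn m D ('D_v f)
  else {in D, continuous f}.

(* A function dom(f) -> R is given by D = dom(f) and a total f whose values
   outside D are irrelevant; D being open, so are the derivatives at points
   of D. *)
Record self_concordant D f : Prop := SelfConcordant {
  sc_open : open D ;
  sc_convex : convex_set D ;
  sc_closed : closed [set p : 'cV[R]_d * R | D p.1 /\ f p.1 <= p.2] ;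
  sc_C3 : Cn 3 D f ;
  sc_hess : {in D, forall x, posdefmx (hess f x)} ;
  sc_third : {in D, forall x y,
    loewner_le (derive1 (fun t : R => hess f (x + t *: y)) 0)
               ((2 * Num.sqrt (dotcv y (hess f x *m y))) *: hess f x)} }.

Definition minimizer D f x : Prop := x \in D /\ {in D, forall z, f x <= f z}.

End SelfConcordance.

Section QuasiNewton.
Context {R : realType} {d : nat}.
Implicit Types (f : 'cV[R]_d -> R) (B : 'M[R]_d) (s y : 'cV[R]_d).

Definition dfp_update B s y : 'M[R]_d :=
  (1%:M - (dotcv y s)^-1 *: (y *m s^T)) *m B
    *m (1%:M - (dotcv s y)^-1 *: (s *m y^T))
  + (dotcv y s)^-1 *: (y *m y^T).

Definition bfgs_update B s y : 'M[R]_d :=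
  B - (dotcv s (B *m s))^-1 *: (B *m s *m s^T *m B)
  + (dotcv s y)^-1 *: (y *m y^T).

Definition quasi_newton (update : 'M[R]_d -> 'cV[R]_d -> 'cV[R]_d -> 'M[R]_d)
    f (x : nat -> 'cV[R]_d) (B : nat -> 'M[R]_d) : Prop :=
  forall k : nat,
    x k.+1 = x k - invmx (B k) *m grad f (x k) /\
    B k.+1 = update (B k) (x k.+1 - x k) (grad f (x k.+1) - grad f (x k)).

End QuasiNewton.

(* Main.v *)
Require Import Defs.
From HB Require Import structures.
From mathcomp Require Import all_boot all_order all_algebra.
From mathcomp Require Import all_classical all_reals all_analysis.
From mathcomp Require Import ring lra spectral complex.
Set Implicit Arguments.
Unset Strict Implicit.
Unset Printing Implicit Defensive.
Import Order.TTheory GRing.Theory Num.Theory.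
Import numFieldNormedType.Exports.
Local Open Scope classical_set_scope.
Local Open Scope ring_scope.

(** Both methods are unchanged when the variable is transformed by the square
    root [S] of the Hessian [H] of [f] at the minimizer: [r = S (x - xs)], the
    gradient becomes [S^-1 grad f x], and [B] becomes [S^-1 B S^-1]
    ([dfp_update_equivariant], [bfgs_update_equivariant]). In these coordinates
    [H] is the identity, and the two hypotheses say that [r_0] is short and that
    [E_0 = B_0 - 1] has small Frobenius norm.

    Self-concordance controls [f] in a ball around the minimizer whose radius
    is absolute in these coordinates. Along a segment of local length [r] issued
    from the minimizer, every form [<u, hess f u>] changes by a relative amount
    of at most [2.1 r] ([hess_quad_close]), so the gradient differs from the
    identity by a relative error [c] proportional to [r] ([grad_diff_close]),
    and the closed epigraph keeps the ball inside the domain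
    ([local_ball_dom]).

    If the gradient difference [y] were equal to the step [s], one update would
    lower [|E|_F^2] by at least [|E s|^2 / (2 |s|^2)]; the actual secant error
    only adds [4 c] to [|E|_F] ([dfp_self_correcting], [bfgs_self_correcting]).
    Hence [E] stays small, the iterates contract by a factor [3] at least, and
    the errors [c_k] form a summable geometric sequence ([linear_step]). On the
    other hand the new gradient is [- E s] up to the secant error, so that
    [|r_(k+1)| / |r_k|] is of the order of [|E_k s_k| / |s_k| + c_k]
    ([superlinear_step]). The squares of these ratios are paid for by the
    decrease of the potential [8 (|E_k|_F^2 + 3 c_k)], which starts below [1]:
    their sum is at most [1], and the inequality between the arithmetic and the
    geometric mean bounds the product of the first [k] of them by [(1/k)^k]
    ([superlinear_of_potential]). Function values follow because
    [f x - f xs] is [|r|^2 / 2] up to a few percent ([f_close]). *)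

(** * The Frobenius inner product *)

Definition frob (R : realType) (m n : nat) (X Y : 'M[R]_(m, n)) : R :=
  \tr (X^T *m Y).

Definition fnorm (R : realType) (m n : nat) (X : 'M[R]_(m, n)) : R :=
  Num.sqrt (frob X X).

Section Frobenius.
Context {R : realType}.

Lemma frobE m n (X Y : 'M[R]_(m, n)) :
  frob X Y = \sum_i \sum_j X i j * Y i j.
Proof.
rewrite exchange_big; apply: eq_bigr => j _; rewrite mxE.
by apply: eq_bigr => i _; rewrite mxE.
Qed.

Lemma frob_cv n (u v : 'cV[R]_n) : frob u v = dotcv u v.
Proof. by rewrite /frob trace_mx11. Qed.

Lemma frobC m n (X Y : 'M[R]_(m, n)) : frob X Y = frob Y X.
Proof. by rewrite !frobE; do 2!apply: eq_bigr => ? _; rewrite mulrC. Qed.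

Lemma frobDr m n (X Y Z : 'M[R]_(m, n)) :
  frob X (Y + Z) = frob X Y + frob X Z.
Proof. by rewrite /frob mulmxDr mxtraceD. Qed.

Lemma frobZr m n a (X Y : 'M[R]_(m, n)) : frob X (a *: Y) = a * frob X Y.
Proof. by rewrite /frob -scalemxAr mxtraceZ. Qed.

Lemma frobNr m n (X Y : 'M[R]_(m, n)) : frob X (- Y) = - frob X Y.
Proof. by rewrite -scaleN1r frobZr mulN1r. Qed.

Lemma frobDl m n (X Y Z : 'M[R]_(m, n)) :
  frob (X + Y) Z = frob X Z + frob Y Z.
Proof. by rewrite ![frob _ Z]frobC frobDr. Qed.

Lemma frobZl m n a (X Y : 'M[R]_(m, n)) : frob (a *: X) Y = a * frob X Y.
Proof. by rewrite ![frob _ Y]frobC frobZr. Qed.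

Lemma frobNl m n (X Y : 'M[R]_(m, n)) : frob (- X) Y = - frob X Y.
Proof. by rewrite ![frob _ Y]frobC frobNr. Qed.

Definition frob_lin := (frobDl, frobDr, frobNl, frobNr, frobZl, frobZr).

Lemma frob_mull m n p (A : 'M[R]_(m, n)) (X : 'M[R]_(n, p)) (Y : 'M[R]_(m, p)) :
  frob (A *m X) Y = frob X (A^T *m Y).
Proof. by rewrite /frob trmx_mul mulmxA. Qed.

Lemma frob_mulr m n p (A : 'M[R]_(n, p)) (X : 'M[R]_(m, n)) (Y : 'M[R]_(m, p)) :
  frob (X *m A) Y = frob X (Y *m A^T).
Proof. by rewrite /frob trmx_mul -mulmxA mxtrace_mulC mulmxA. Qed.

Lemma frob_tr m n (X Y : 'M[R]_(m, n)) : frob X^T Y^T = frob X Y.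
Proof. by rewrite /frob trmxK mxtrace_mulC -mxtrace_tr trmx_mul trmxK. Qed.

(** The pairing with a rank-one matrix is a bilinear form; this turns the
    norms of rank-one corrections into scalar computations. *)
Lemma frob_rank1 m n (X : 'M[R]_(m, n)) (u : 'cV[R]_m) (v : 'cV[R]_n) :
  frob X (u *m v^T) = frob u (X *m v).
Proof. by rewrite frobC frob_mulr trmxK. Qed.

Lemma frob_rank1_rank1 m n (u p : 'cV[R]_m) (v q : 'cV[R]_n) :
  frob (u *m v^T) (p *m q^T) = frob u p * frob v q.
Proof.
rewrite frob_rank1 -mulmxA [v^T *m q]mx11_scalar -[X in X%:M]/(dotcv v q).
by rewrite mul_mx_scalar frobZr -frob_cv mulrC (frobC p).
Qed.

Lemma frob_ge0 m n (X : 'M[R]_(m, n)) : 0 <= frob X X.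
Proof.
by rewrite frobE; do 2!apply: sumr_ge0 => ? _; rewrite -expr2 sqr_ge0.
Qed.

Lemma frob_eq0 m n (X : 'M[R]_(m, n)) : (frob X X == 0) = (X == 0).
Proof.
apply/eqP/eqP => [|->]; last by rewrite /frob mulmx0 mxtrace0.
rewrite frobE => /eqP X0; apply/matrixP => i j; rewrite mxE; apply/eqP.
move: X0; rewrite psumr_eq0 => [/allP/(_ i)|? _]; last first.
  by apply: sumr_ge0 => ? _; rewrite -expr2 sqr_ge0.
rewrite mem_index_enum => /(_ isT); rewrite psumr_eq0 => [/allP/(_ j)|? _].
  by rewrite mem_index_enum => /(_ isT); rewrite mulf_eq0 orbb.
by rewrite -expr2 sqr_ge0.
Qed.

Lemma fnorm_ge0 m n (X : 'M[R]_(m, n)) : 0 <= fnorm X.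
Proof. exact: sqrtr_ge0. Qed.

Lemma sqr_fnorm m n (X : 'M[R]_(m, n)) : fnorm X ^+ 2 = frob X X.
Proof. by rewrite sqr_sqrtr ?frob_ge0. Qed.

Lemma fnorm_eq0 m n (X : 'M[R]_(m, n)) : (fnorm X == 0) = (X == 0).
Proof. by rewrite -frob_eq0 -sqr_fnorm expf_eq0. Qed.

Lemma fnorm_gt0 m n (X : 'M[R]_(m, n)) : (0 < fnorm X) = (X != 0).
Proof. by rewrite lt_def fnorm_ge0 andbT fnorm_eq0. Qed.

Lemma fnorm_leP m n (X : 'M[R]_(m, n)) c :
  0 <= c -> (fnorm X <= c) = (frob X X <= c ^+ 2).
Proof. by move=> c0; rewrite -sqr_fnorm ler_pXn2r ?nnegrE ?fnorm_ge0. Qed.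

Lemma fnorm_cv n (u : 'cV[R]_n) : fnorm u = norm2 u.
Proof.
by congr Num.sqrt; rewrite frobE; apply: eq_bigr => i _; rewrite big_ord1.
Qed.

Lemma fnorm_sq n (X : 'M[R]_n) : fnorm X = normF X.
Proof. by congr Num.sqrt; rewrite frobE. Qed.

Lemma fnorm_tr m n (X : 'M[R]_(m, n)) : fnorm X^T = fnorm X.
Proof. by rewrite /fnorm frob_tr. Qed.

Lemma fnormZ m n a (X : 'M[R]_(m, n)) : fnorm (a *: X) = `|a| * fnorm X.
Proof. by rewrite /fnorm !frob_lin mulrA -expr2 sqrtrM ?sqr_ge0 // sqrtr_sqr. Qed.

Lemma fnormN m n (X : 'M[R]_(m, n)) : fnorm (- X) = fnorm X.
Proof. by rewrite -scaleN1r fnormZ normrN1 mul1r. Qed.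

Lemma fnorm0 m n : fnorm (0 : 'M[R]_(m, n)) = 0.
Proof. by apply/eqP; rewrite fnorm_eq0. Qed.

Lemma frob_CS m n (X Y : 'M[R]_(m, n)) : `|frob X Y| <= fnorm X * fnorm Y.
Proof.
have [->|Y0] := eqVneq Y 0.
  by rewrite /frob mulmx0 mxtrace0 normr0 mulr_ge0 ?fnorm_ge0.
have c0 : 0 < frob Y Y by rewrite lt_def frob_ge0 frob_eq0 Y0.
have := frob_ge0 (frob Y Y *: X - frob X Y *: Y).
rewrite !frob_lin (frobC Y X) => h.
have {}h : 0 <= frob Y Y * (frob X X * frob Y Y - frob X Y ^+ 2) by nra.
rewrite pmulr_rge0 // subr_ge0 in h.
rewrite -(@ler_pXn2r _ 2) ?nnegrE ?mulr_ge0 ?fnorm_ge0 //.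
by rewrite -normrX ger0_norm ?sqr_ge0 // exprMn !sqr_fnorm.
Qed.

Lemma frob_le m n (X Y : 'M[R]_(m, n)) : frob X Y <= fnorm X * fnorm Y.
Proof. exact: le_trans (ler_norm _) (frob_CS _ _). Qed.

Lemma fnormD m n (X Y : 'M[R]_(m, n)) : fnorm (X + Y) <= fnorm X + fnorm Y.
Proof.
rewrite fnorm_leP ?addr_ge0 ?fnorm_ge0 // !frob_lin (frobC Y X).
by have := frob_le X Y; rewrite -!sqr_fnorm; lra.
Qed.

Lemma fnormB m n (X Y : 'M[R]_(m, n)) : fnorm (X - Y) <= fnorm X + fnorm Y.
Proof. by rewrite -[fnorm Y]fnormN fnormD. Qed.

(** The Frobenius norm is submultiplicative also on rectangular matrices, so
    that one inequality bounds both [X v] and the rank-one matrix [u v^T]. *)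
Lemma fnormM m n p (X : 'M[R]_(m, n)) (Y : 'M[R]_(n, p)) :
  fnorm (X *m Y) <= fnorm X * fnorm Y.
Proof.
rewrite fnorm_leP ?mulr_ge0 ?fnorm_ge0 // exprMn !sqr_fnorm.
rewrite -(frob_tr Y) ![frob _ _]frobE mulr_suml; apply: ler_sum => i _.
rewrite mulr_sumr; apply: ler_sum => j _.
suff -> : (X *m Y) i j * (X *m Y) i j = frob (row i X) (row j Y^T) ^+ 2.
  have -> : \sum_j X i j * X i j = fnorm (row i X) ^+ 2.
    by rewrite sqr_fnorm frobE big_ord1; apply: eq_bigr => k _; rewrite !mxE.
  have -> : \sum_i Y^T j i * Y^T j i = fnorm (row j Y^T) ^+ 2.
    by rewrite sqr_fnorm frobE big_ord1; apply: eq_bigr => k _; rewrite !mxE.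
  rewrite -exprMn -real_normK ?num_real // ler_sqr ?frob_CS //.
  by rewrite nnegrE ?mulr_ge0 ?fnorm_ge0.
rewrite -expr2 frobE big_ord1 mxE; congr (_ ^+ 2).
by apply: eq_bigr => k _; rewrite !mxE.
Qed.

Lemma fnorm_rank1 m n (u : 'cV[R]_m) (v : 'cV[R]_n) :
  fnorm (u *m v^T) <= fnorm u * fnorm v.
Proof. by rewrite -(fnorm_tr v) fnormM. Qed.

End Frobenius.

(** * The quasi-Newton updates *)

(** [g] bounds the error that the update would leave for an exact secant pair
    [y = s]: its square is smaller than that of the old error by the relative
    size of [(B - 1) s]. The term [4 * c] is the price of the secant error. *)
Definition self_correcting (R : realType) (d : nat)
    (upd : 'M[R]_d -> 'cV[R]_d -> 'cV[R]_d -> 'M[R]_d) : Prop :=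
  forall B s y c, B^T = B -> fnorm (B - 1%:M) <= 1 / 5 -> s != 0 ->
    c <= 1 / 100 -> fnorm (y - s) <= c * fnorm s ->
  (upd B s y)^T = upd B s y /\
  exists2 g, 0 <= g /\ fnorm (upd B s y - 1%:M) <= g + 4 * c &
    g ^+ 2 <= fnorm (B - 1%:M) ^+ 2
              - (fnorm ((B - 1%:M) *m s) / fnorm s) ^+ 2 / 2.

(** With [S] a square root of the Hessian at the minimizer and [T] its inverse,
    this is what reduces the analysis to a Hessian equal to the identity. *)
Definition congruence_equivariant (R : realType) (d : nat)
    (upd : 'M[R]_d -> 'cV[R]_d -> 'cV[R]_d -> 'M[R]_d) : Prop :=
  forall B s y S T, S^T = S -> T^T = T -> S *m T = 1%:M -> T *m S = 1%:M ->
    upd (T *m B *m T) (S *m s) (T *m y) = T *m upd B s y *m T.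

Section Updates.
Context {R : realType} {d : nat}.
Implicit Types (B E S T : 'M[R]_d) (a b s y u v w : 'cV[R]_d).

Lemma dotcvC u v : dotcv u v = dotcv v u.
Proof. by rewrite -!frob_cv frobC. Qed.

Lemma dotcvZ (t r : R) u v : dotcv (t *: u) (r *: v) = t * r * dotcv u v.
Proof. by rewrite -!frob_cv !frob_lin mulrA. Qed.

Lemma rank1Z (t r : R) u v : t != 0 ->
  (t * t * r)^-1 *: (t *: u *m (t *: v)^T) = r^-1 *: (u *m v^T).
Proof.
move=> t0; rewrite [(t *: v)^T]linearZ /= -scalemxAl -scalemxAr !scalerA.
by rewrite invfM -[_ * t * t]mulrA mulrAC mulVf ?mul1r // mulf_neq0.
Qed.

Lemma dfp_updateZ B s y (t : R) : t != 0 ->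
  dfp_update B (t *: s) (t *: y) = dfp_update B s y.
Proof. by move=> t0; rewrite /dfp_update !dotcvZ !rank1Z. Qed.

Lemma bfgs_updateZ B s y (t : R) : t != 0 ->
  bfgs_update B (t *: s) (t *: y) = bfgs_update B s y.
Proof.
move=> t0; rewrite /bfgs_update -!scalemxAr !dotcvZ rank1Z //.
by rewrite ![_ *: (_ *m _ *m B)]scalemxAl rank1Z.
Qed.

Lemma dotcv_congr S T u v : S^T = S -> T *m S = 1%:M ->
  dotcv (S *m u) (T *m v) = dotcv u v.
Proof.
move=> ST TS; rewrite -!frob_cv frob_mull mulmxA.
by rewrite ST (mulmx1C TS) mul1mx.
Qed.

Lemma dfp_update_equivariant : congruence_equivariant (@dfp_update R d).
Proof.
move=> B s y S T ST TT STE TSE.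
rewrite /dfp_update (dotcvC (S *m s)) !(dotcv_congr _ _ TT) //.
have tr u v : (T *m u *m (S *m v)^T) = T *m (u *m v^T) *m S.
  by rewrite trmx_mul ST !mulmxA.
have tr' u v : (S *m u *m (T *m v)^T) = S *m (u *m v^T) *m T.
  by rewrite trmx_mul TT !mulmxA.
have trr u v : (T *m u *m (T *m v)^T) = T *m (u *m v^T) *m T.
  by rewrite trmx_mul TT !mulmxA.
rewrite tr tr' trr.
have l (r : R) X : 1%:M - r *: (T *m X *m S) = T *m (1%:M - r *: X) *m S.
  by rewrite mulmxBr mulmx1 mulmxBl TSE -scalemxAr -scalemxAl.
have l' (r : R) X : 1%:M - r *: (S *m X *m T) = S *m (1%:M - r *: X) *m T.
  by rewrite mulmxBr mulmx1 mulmxBl STE -scalemxAr -scalemxAl.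
rewrite l l' [X in _ = X *m _]mulmxDr [RHS]mulmxDl -scalemxAr -scalemxAl.
rewrite (dotcvC s y); congr (_ + _).
by rewrite -!mulmxA (mulmxA S T) STE mul1mx (mulmxA T S) TSE mul1mx.
Qed.

Lemma bfgs_update_equivariant : congruence_equivariant (@bfgs_update R d).
Proof.
move=> B s y S T ST TT STE TSE.
have TBs : T *m B *m T *m (S *m s) = T *m (B *m s).
  by rewrite -!mulmxA (mulmxA T S) TSE mul1mx.
rewrite /bfgs_update TBs !(dotcv_congr _ _ ST) //.
rewrite mulmxDr mulmxDl mulmxBr mulmxBl -!scalemxAr -!scalemxAl.
congr (_ - _ *: _ + _ *: _); last by rewrite trmx_mul TT !mulmxA.
rewrite trmx_mul ST !mulmxA -(mulmxA _ S T) STE mulmx1.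
by rewrite -!mulmxA.
Qed.

Definition oproj a : 'M[R]_d := 1%:M - a *m a^T.

Lemma oproj_tr a : (oproj a)^T = oproj a.
Proof. by rewrite /oproj linearB /= trmx1 trmx_mul trmxK. Qed.

(** Pythagoras: [E] is the sum of [E *m oproj a] and [(E a) a^T], which are
    orthogonal. *)
Lemma frob_oprojr E a : frob a a = 1 ->
  frob (E *m oproj a) (E *m oproj a) = frob E E - frob (E *m a) (E *m a).
Proof.
move=> a1; rewrite /oproj mulmxBr mulmx1 mulmxA !frob_lin.
rewrite (frobC (_ *m a^T)) !frob_rank1 -(mulmxA (E *m a)).
have -> : a^T *m a = 1%:M :> 'M[R]_1.
  by rewrite [LHS]mx11_scalar -[X in X%:M]/(dotcv a a) -frob_cv a1.
rewrite mulmx1; ring.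
Qed.

Lemma fnorm_oprojr E a : frob a a = 1 -> fnorm (E *m oproj a) <= fnorm E.
Proof.
move=> a1; rewrite fnorm_leP ?fnorm_ge0 // frob_oprojr // sqr_fnorm.
by rewrite gerBl frob_ge0.
Qed.

Lemma fnorm_oprojl E a : frob a a = 1 -> fnorm (oproj a *m E) <= fnorm E.
Proof.
by move=> a1; rewrite -fnorm_tr trmx_mul oproj_tr -(fnorm_tr E) fnorm_oprojr.
Qed.

End Updates.

(** * How one update corrects the Hessian approximation *)

Section UpdateBounds.
Context {R : realType} {d : nat}.
Implicit Types (B E S T : 'M[R]_d) (a b s y u v w : 'cV[R]_d).

(** For a unit step [a], the gradient difference [y] enters the updates through
    [r = <y, a>] and the part [w] orthogonal to [a]. The DFP factor
    [1 - a y^T / r] is then the orthogonal projection plus [a w^T]. *)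
Lemma secant_split a y (c : R) (r := dotcv y a) (w := a - r^-1 *: y) :
  frob a a = 1 -> c <= 1 / 100 -> fnorm (y - a) <= c ->
  [/\ `|r - 1| <= c, y = r *: (a - w), frob a w = 0
    & fnorm w <= 102 / 100 * c].
Proof.
move=> a1 c1 yac; have fa1 : fnorm a = 1 by rewrite /fnorm a1 sqrtr1.
have c0 : 0 <= c := le_trans (fnorm_ge0 _) yac.
have rE : r = frob y a by rewrite frob_cv.
have r1 : `|r - 1| <= c.
  rewrite rE -a1 -frobNl -frobDl (le_trans (frob_CS _ _)) //.
  by rewrite fa1 mulr1.
have r0 : 0 < r by move: r1; rewrite ler_norml => /andP[]; lra.
split => //.
- by rewrite /w opprB addrC subrK scalerA mulfV ?gt_eqF // scale1r.
- by rewrite /w !frob_lin a1 (frobC a) -rE mulVf ?subrr // gt_eqF.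
- have rw : fnorm (r *: w) <= c.
    rewrite fnorm_leP // /w scalerBr scalerA mulfV ?gt_eqF // scale1r.
    move: yac; rewrite fnorm_leP // !frob_lin a1 (frobC a y) -rE.
    by have := sqr_ge0 (r - 1); lra.
  (* [102 / 100] exceeds [1 / (1 - c)], and [1 - c] is a lower bound of [r]. *)
  rewrite fnormZ gtr0_norm // in rw.
  have w0 := fnorm_ge0 w.
  by move: r1; rewrite ler_norml => /andP[? _]; nra.
Qed.

(** Both updates end with a rank-one term [y y^T / <y, a>] that enforces the
    secant equation. For an exact pair it would be [a a^T]; the difference is
    the whole BFGS perturbation and the main part of the DFP one. *)
Lemma secant_term_bound a y (c : R) : frob a a = 1 -> c <= 1 / 100 ->
  fnorm (y - a) <= c ->
  fnorm ((dotcv y a)^-1 *: (y *m y^T) - a *m a^T) <= 31 / 10 * c.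
Proof.
move=> a1 c1 yac; have [] := secant_split a1 c1 yac.
set r := dotcv y a; set w := a - _ *: _ => r1 yE _ wc.
have c0 : 0 <= c := le_trans (fnorm_ge0 _) yac.
have fa1 : fnorm a = 1 by rewrite /fnorm a1 sqrtr1.
have r0 : 0 < r by move: r1; rewrite ler_norml => /andP[]; lra.
have -> : r^-1 *: (y *m y^T) - a *m a^T =
    r *: (w *m w^T - w *m a^T - a *m w^T) + (r - 1) *: (a *m a^T).
  rewrite yE [(r *: _)^T]linearZ /= -scalemxAl -scalemxAr !scalerA mulVf ?gt_eqF //.
  rewrite mul1r [(a - w)^T]linearB /= mulmxBl !mulmxBr.
  move: (a *m a^T) (a *m w^T) (w *m a^T) (w *m w^T) => aa aw wa ww.
  by apply/matrixP => i j; rewrite !mxE; ring.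
apply: le_trans (fnormD _ _) _; rewrite !fnormZ (gtr0_norm r0).
have := fnormB (w *m w^T - w *m a^T) (a *m w^T).
have := fnormB (w *m w^T) (w *m a^T).
have := fnorm_rank1 w w; have := fnorm_rank1 w a; have := fnorm_rank1 a w.
have := fnorm_rank1 a a; rewrite fa1 !mul1r !mulr1.
have := fnorm_ge0 w.
set f1 := fnorm (_ - a *m w^T).
set f2 := fnorm (a *m a^T).
move=> w0 h1 h2 h3 h4 h5 h6.
have hf : f1 <= 206 / 100 * c.
  have : fnorm w * fnorm w <= 102 / 100 * c * (11 / 1000).
    by apply: ler_pM => //; lra.
  by lra.
have f10 : 0 <= f1 by exact: fnorm_ge0.
have f20 : 0 <= f2 by exact: fnorm_ge0.
have : `|r - 1| * f2 <= c * 1 by exact: ler_pM.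
have : r * f1 <= (101/100) * (206 / 100 * c).
  apply: ler_pM => //; first exact: ltW.
  by move: r1; rewrite ler_norml => /andP[]; lra.
by lra.
Qed.

Lemma symm_frob B u v : B^T = B -> frob u (B *m v) = frob (B *m u) v.
Proof. by move=> BT; rewrite frob_mull BT. Qed.

(** The updates see only the direction of the secant pair, so that the step may
    be taken of length [1]. *)
Lemma self_correcting_unit (upd : 'M[R]_d -> 'cV[R]_d -> 'cV[R]_d -> 'M[R]_d) :
  (forall B s y t, t != 0 -> upd B (t *: s) (t *: y) = upd B s y) ->
  (forall B a y c, B^T = B -> fnorm (B - 1%:M) <= 1 / 5 -> frob a a = 1 ->
    c <= 1 / 100 -> fnorm (y - a) <= c ->
    (upd B a y)^T = upd B a y /\
    exists2 g, 0 <= g /\ fnorm (upd B a y - 1%:M) <= g + 4 * c &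
      g ^+ 2 <= fnorm (B - 1%:M) ^+ 2 - fnorm ((B - 1%:M) *m a) ^+ 2 / 2) ->
  self_correcting upd.
Proof.
move=> updZ H B s y c BT Bs s0 c1 yc.
have n0 : 0 < fnorm s by rewrite fnorm_gt0.
have t0 : (fnorm s)^-1 != 0 by rewrite invr_eq0 gt_eqF.
rewrite -(updZ B s y _ t0).
have a1 : frob ((fnorm s)^-1 *: s) ((fnorm s)^-1 *: s) = 1.
  by rewrite !frob_lin -sqr_fnorm; field; rewrite gt_eqF.
have ync : fnorm ((fnorm s)^-1 *: y - (fnorm s)^-1 *: s) <= c.
  rewrite -scalerBr fnormZ gtr0_norm ?invr_gt0 //.
  by rewrite ler_pdivrMl // mulrC.
have [hT [g hg1 hg2]] := H _ _ _ _ BT Bs a1 c1 ync.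
split => //; exists g => //.
by move: hg2; rewrite -scalemxAr fnormZ gtr0_norm ?invr_gt0 // [_^-1 * _]mulrC.
Qed.

(** For an exact secant pair the new error is [P E P], where [P] is the
    orthogonal projection along [s]: one factor removes [E s], the other cannot
    increase the norm. In general the outer factors are [P + U] and [P + U^T]
    with [U = w a^T] small, and [U P = 0] leaves few cross terms. *)
Lemma dfp_self_correcting : self_correcting (@dfp_update R d).
Proof.
apply: self_correcting_unit => [B s y t|B a y c BT Be a1 c1 yac].
  exact: dfp_updateZ.
have [] := secant_split a1 c1 yac.
have := secant_term_bound a1 c1 yac.
rewrite /dfp_update (dotcvC a y).
set r := dotcv y a; set w := a - _ *: _; set N := _ - a *m a^T.
move=> hN r1 yE aw wc.
have c0 : 0 <= c := le_trans (fnorm_ge0 _) yac.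
have fa1 : fnorm a = 1 by rewrite /fnorm a1 sqrtr1.
pose P := oproj a; have Pd : P = oproj a by [].
set U := w *m a^T; set E := B - 1%:M.
have PT : P^T = P by exact: oproj_tr.
have aa : a^T *m a = 1%:M :> 'M[R]_1.
  by rewrite [LHS]mx11_scalar -[X in X%:M]/(dotcv a a) -frob_cv a1.
have Pa : P *m a = 0 by rewrite /P /oproj mulmxBl mul1mx -mulmxA aa mulmx1 subrr.
have aP : a^T *m P = 0 by rewrite -PT -trmx_mul Pa trmx0.
have PP : P *m P = P by rewrite {2}/P /oproj mulmxBr mulmx1 mulmxA Pa mul0mx subr0.
have UT : U^T = a *m w^T by rewrite trmx_mul trmxK.
have QE : 1%:M - r^-1 *: (a *m y^T) = P + U^T.
  rewrite UT [w^T]linearB /= [(_ *: y)^T]linearZ /= mulmxBr -scalemxAr.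
  by rewrite addrA subrK.
have QTE : 1%:M - r^-1 *: (y *m a^T) = P + U.
  have := congr1 trmx QE.
  by rewrite linearB linearD /= linearZ /= trmx1 trmx_mul !trmxK PT.
have PE : 1%:M = P + a *m a^T by rewrite subrK.
clearbody P; have BE : B = E + 1%:M by rewrite subrK.
rewrite QE QTE; split.
  have QT : (P + U)^T = P + U^T by rewrite linearD /= PT.
  rewrite [LHS]linearD /= [(_ *: _)^T]linearZ /= (trmx_mul y) trmxK -QT.
  by rewrite !trmx_mul trmxK BT mulmxA.
have UE : fnorm U <= 102 / 100 * c.
  by apply: le_trans (fnorm_rank1 _ _) _; rewrite fa1 mulr1.
set F := U *m E *m P + P *m E *m U^T + U *m E *m U^T.
have dec : (P + U) *m B *m (P + U^T) + r^-1 *: (y *m y^T) - 1%:M =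
   P *m E *m P + (F + w *m w^T + N).
  have PU : P *m U^T = 0 by rewrite UT mulmxA Pa mul0mx.
  have UP : U *m P = 0 by rewrite /U -mulmxA aP mulmx0.
  have UU : U *m U^T = w *m w^T.
    by rewrite UT /U !mulmxA -(mulmxA w) aa mulmx1.
  have -> : (P + U) *m B *m (P + U^T) =
      (P + U) *m E *m (P + U^T) + (P + U) *m (P + U^T).
    by rewrite BE [_ *m (E + _)]mulmxDr mulmx1 [LHS]mulmxDl.
  have -> : (P + U) *m (P + U^T) = P + w *m w^T.
    by rewrite mulmxDl !mulmxDr PP PU UP UU addr0 add0r.
  have -> : (P + U) *m E *m (P + U^T) =
      P *m E *m P + P *m E *m U^T + U *m E *m P + U *m E *m U^T.
    by rewrite [(P + U) *m E]mulmxDl mulmxDl !mulmxDr !addrA.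
  rewrite /N /F PE.
  move: (P *m E *m P) (P *m E *m U^T) (U *m E *m P) (U *m E *m U^T).
  move: (w *m w^T) (r^-1 *: _) (a *m a^T) => x1 x2 x3 x4 x5 x6 x7.
  by apply/matrixP => i j; rewrite !mxE; ring.
exists (fnorm (P *m E *m P)); last first.
  have : fnorm (P *m E *m P) ^+ 2 <= fnorm (E *m P) ^+ 2.
    by rewrite ler_sqr ?nnegrE ?fnorm_ge0 // -mulmxA Pd fnorm_oprojl.
  rewrite [X in _ <= X]sqr_fnorm Pd frob_oprojr // -!sqr_fnorm => h.
  by have := sqr_ge0 (fnorm (E *m a)); lra.
split; first exact: fnorm_ge0.
rewrite dec; apply: le_trans (fnormD _ _) _; rewrite lerD2l.
have eE : fnorm E <= 1 / 5 by [].
have uE : fnorm (U *m E) <= 102 / 100 * c * (1 / 5).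
  by apply: le_trans (fnormM _ _) _; apply: ler_pM; rewrite ?fnorm_ge0 //.
have f1 : fnorm (U *m E *m P) <= 102 / 100 * c * (1 / 5).
  by apply: le_trans uE; rewrite Pd fnorm_oprojr.
have f2 : fnorm (P *m E *m U^T) <= 102 / 100 * c * (1 / 5).
  rewrite -fnorm_tr trmx_mul [(P *m E)^T]trmx_mul trmxK Pd oproj_tr mulmxA.
  apply: le_trans (fnorm_oprojr _ a1) _; apply: le_trans (fnormM _ _) _.
  by apply: ler_pM; rewrite ?fnorm_ge0 ?fnorm_tr //.
have f3 : fnorm (U *m E *m U^T) <= 102 / 100 * c * (1 / 5) * (102 / 100 * c).
  apply: le_trans (fnormM _ _) _; rewrite fnorm_tr.
  by apply: ler_pM; rewrite ?fnorm_ge0 //.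
have f4 : fnorm (w *m w^T) <= 102 / 100 * c * (102 / 100 * c).
  by apply: le_trans (fnorm_rank1 _ _) _; apply: ler_pM; rewrite ?fnorm_ge0 //.
have := fnormD (F + w *m w^T) N; have := fnormD F (w *m w^T).
have := fnormD (U *m E *m P + P *m E *m U^T) (U *m E *m U^T).
have := fnormD (U *m E *m P) (P *m E *m U^T).
have cc : c * c <= c * (1 / 100) by exact: ler_wpM2l.
rewrite -/F; lra.
Qed.

(** For an exact secant pair the squared error drops by at least
    [<E s, B E s> / <s, B s>]: when the square is expanded, what remains beside
    this cancels or is non-positive, by the Cauchy-Schwarz inequality for the
    form [B]. Since [B] is within [1/5] of the identity, this is at least
    [2/3] of [|E s|^2 / |s|^2]. *)
Lemma bfgs_self_correcting : self_correcting (@bfgs_update R d).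
Proof.
apply: self_correcting_unit => [B s y t|B a y c BT Be a1 c1 yac].
  exact: bfgs_updateZ.
have := secant_term_bound a1 c1 yac.
rewrite /bfgs_update (dotcvC a y) -(frob_cv a).
set r := dotcv y a; set N := _ - a *m a^T => hN.
have c0 : 0 <= c := le_trans (fnorm_ge0 _) yac.
have fa1 : fnorm a = 1 by rewrite /fnorm a1 sqrtr1.
set b := B *m a; set E := B - 1%:M; set be := frob a b.
have bbT : b *m a^T *m B = b *m b^T by rewrite /b trmx_mul BT mulmxA.
have BE : B = E + 1%:M by rewrite subrK.
rewrite bbT; split.
  by rewrite linearD linearB /= !linearZ /= !trmx_mul !trmxK BT.
have Ev v : frob v (E *m v) <= 1 / 5 * frob v v /\
    - (1 / 5 * frob v v) <= frob v (E *m v).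
  have : `|frob v (E *m v)| <= 1 / 5 * frob v v.
    apply: le_trans (frob_CS _ _) _; rewrite -sqr_fnorm expr2 mulrCA.
    apply: ler_wpM2l; rewrite ?fnorm_ge0 // (le_trans (fnormM E v)) //.
    by rewrite ler_wpM2r ?fnorm_ge0.
  by rewrite ler_norml => /andP[? ?]; split.
have Bv v : B *m v = E *m v + v by rewrite BE mulmxDl mul1mx.
have beE : be = frob a (E *m a) + 1 by rewrite /be /b Bv !frob_lin a1.
have [be1 be2] := Ev a; rewrite a1 in be1 be2.
have be0 : 0 < be by lra.
rewrite -/E in Be; clearbody E.
set G := E - be^-1 *: (b *m b^T) + a *m a^T.
have GE : B - be^-1 *: (b *m b^T) + r^-1 *: (y *m y^T) - 1%:M = G + N.
  rewrite /G /N BE; move: (b *m b^T) (a *m a^T) (y *m y^T) => x1 x2 x3.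
  by apply/matrixP => i j; rewrite !mxE; ring.
exists (fnorm G).
  split; first exact: fnorm_ge0.
  by rewrite GE; have := fnormD G N; lra.
set n := frob b b; set C := frob b (B *m b).
have frobG : frob G G = frob E E + be^-1 ^+ 2 * n ^+ 2 + 1
   - 2 * be^-1 * (C - n) + 2 * (be - 1) - 2 * be^-1 * be ^+ 2.
  have EbC : frob E (b *m b^T) = C - n.
    by rewrite frob_rank1 /C Bv !frob_lin addrK.
  have Eab : frob E (a *m a^T) = be - 1 by rewrite frob_rank1 beE addrK.
  rewrite /G !frob_lin !(frobC _ E) EbC Eab !frob_rank1_rank1 a1 -/n.
  by rewrite (frobC b a) -/be; ring.
rewrite !sqr_fnorm frobG.
have EaE : frob (E *m a) (E *m a) = n - 2 * be + 1.
  have -> : E *m a = b - a by rewrite /b Bv addrK.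
  by rewrite !frob_lin (frobC b a) a1 -/n -/be; ring.
have Eac : 4 / 5 * (n - 2 * be + 1) <= C - 2 * n + be.
  have [_ h] := Ev (E *m a).
  have : frob (E *m a) (B *m (E *m a)) = C - 2 * n + be.
    have -> : E *m a = b - a by rewrite /b Bv addrK.
    rewrite mulmxBr -/b !frob_lin -/be -/n -/C.
    by rewrite [frob a (B *m b)]symm_frob // -/b -/n; ring.
  by rewrite Bv frob_lin EaE; rewrite EaE in h; lra.
(* The form [B] is non-negative at this vector, the standard witness for the
   Cauchy-Schwarz inequality between [b] and [a]. *)
have CS : n ^+ 2 <= C * be.
  have [_ h] := Ev (be *: b - n *: a).
  have h0 := frob_ge0 (be *: b - n *: a).
  have : 0 <= frob (be *: b - n *: a) (B *m (be *: b - n *: a)).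
    by rewrite Bv frobDr; lra.
  rewrite mulmxBr -!scalemxAr -/b !frob_lin.
  rewrite [frob a (B *m b)]symm_frob // -/b -/n -/be -/C => h1.
  have : 0 <= be * (C * be - n ^+ 2) by lra.
  by rewrite pmulr_rge0 // subr_ge0.
have iv : be * be^-1 = 1 by rewrite mulfV // gt_eqF.
have i0 : 0 < be^-1 by rewrite invr_gt0.
rewrite EaE; set i := be^-1 in iv i0 *.
have n0 : 0 <= n - 2 * be + 1 by rewrite -EaE frob_ge0.
have h1 : i ^+ 2 * n ^+ 2 <= i * C.
  have := ler_wpM2l (ltW (exprn_gt0 2 i0)) CS.
  suff -> : i ^+ 2 * (C * be) = i * C * (be * i) by rewrite iv mulr1.
  by ring.
have h2 : i * (4 / 5 * (n - 2 * be + 1)) <= i * (C - 2 * n + be).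
  by rewrite ler_pM2l.
have i5 : 5 / 6 <= i by nra.
have h3 : 5 / 6 * (n - 2 * be + 1) <= i * (n - 2 * be + 1) by rewrite ler_wpM2r.
have -> : 2 * i * be ^+ 2 = 2 * be * (be * i) by ring.
rewrite iv mulr1; lra.
Qed.

End UpdateBounds.

(** * Square roots of positive definite matrices *)

Section SquareRoot.

Lemma poly_interpolation (F : fieldType) (g : F -> F) (s : seq F) :
  exists p : {poly F}, forall x, x \in s -> p.[x] = g x.
Proof.
elim: s => [|a s [p ps]]; first by exists 0.
have [as_|as_] := boolP (a \in s).
  by exists p => x; rewrite inE => /predU1P[->|]; exact: ps.
pose q := \prod_(b <- s) ('X - b%:P).
have qs x : root q x = (x \in s) by rewrite root_prod_XsubC.
have qa : q.[a] != 0 by rewrite -[_ == _]/(root q a) qs.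
exists (p + ((g a - p.[a]) / q.[a]) *: q) => x; rewrite inE hornerD hornerZ.
case/predU1P => [->|xs]; first by rewrite divfK // addrC subrK.
by move: (xs); rewrite -qs => /rootP ->; rewrite mulr0 addr0 ps.
Qed.

Lemma trmx_horner (R : comNzRingType) n (A : 'M[R]_n.+1) (p : {poly R}) :
  (horner_mx A p)^T = horner_mx A^T p.
Proof.
elim/poly_ind: p => [|p c IH]; first by rewrite !rmorph0 trmx0.
rewrite !rmorphD !rmorphM /= !horner_mx_X !horner_mx_C linearD /= tr_scalar_mx.
congr (_ + _); rewrite -[_ * _]/(horner_mx A p *m A) trmx_mul IH.
exact: (comm_mx_horner p (comm_mx_refl _)).
Qed.

(** Over the complex closure the matrix is diagonalizable, with real
    eigenvalues because it is Hermitian; a polynomial vanishing at all of them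
    therefore kills it. *)
Lemma symm_annihilator (R : rcfType) n (A : 'M[R]_n.+1) : A^T = A ->
  exists l : 'I_n.+1 -> R, (forall i, eigenvalue A (l i)) /\
    forall p : {poly R}, (forall i, p.[l i] = 0) -> horner_mx A p = 0.
Proof.
move=> AT; pose io : {rmorphism R -> R[i]} := real_complex R.
pose AC := map_mx io A.
have ACr : AC \is a mxOver Num.real.
  apply/mxOverP => i j; rewrite mxE; apply/complex_realP; by exists (A i j).
have ACs : AC \is symmetricmx.
  apply/is_hermitianmxP; rewrite expr0 scale1r map_mx_id //.
  by rewrite map_trmx AT.
have ACh := realsym_hermsym ACs ACr.
have /orthomx_spectralP ACE := hermitian_normalmx ACh.
set P := spectralmx AC in ACE; set sp := spectral_diag AC in ACE.
have Pu : P \in unitmx by exact: spectral_unit.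
have /mxOverP spr := hermitian_spectral_diag_real ACh.
have /choice[l lE] : forall i, exists x, sp 0 i = io x.
  by move=> i; have /complex_realP[x xE] := spr 0 i; exists x.
exists l; split => [i|p pl].
  rewrite -(eigenvalue_map io) -lE; apply/eigenvalueP; exists (row i P).
    rewrite -row_mul -/AC ACE !mulmxA mulmxV // mul1mx.
    by apply/rowP => j; rewrite !mxE (bigD1 i) //= big1 ?addr0 => [|k ki];
      rewrite !mxE ?eqxx ?mulr1n // eq_sym (negPf ki) mulr0n mul0r.
  apply/eqP => Pi0; have /eqP : row i P *m invmx P = 0 by rewrite Pi0 mul0mx.
  rewrite -row_mul mulmxV // => /eqP/rowP/(_ i); rewrite !mxE eqxx.
  by move/eqP; rewrite oner_eq0.
apply: (map_mx_inj (f := io)); rewrite map_horner_mx map_mx0 -/AC ACE.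
rewrite horner_mx_uconjC // horner_mx_diag.
suff -> : map_mx (horner (map_poly io p)) sp = 0.
  by rewrite linear0 mulmx0 mul0mx.
by apply/rowP => i; rewrite !mxE lE horner_map pl rmorph0.
Qed.

(** The root is a polynomial in [A] interpolating the square root at the
    eigenvalues. Taking it as the square of a fourth root [Q] makes positivity
    immediate: [<v, Q Q v> = |Q v|^2]. *)
Lemma sqrtmx_exists (R : realType) n (A : 'M[R]_n) : posdefmx A ->
  exists S : 'M[R]_n, posdefmx S /\ S *m S = A.
Proof.
case: n A => [|n] A [AT Apos].
  exists A; split; last by rewrite [LHS]flatmx0 [RHS]flatmx0.
  by split.
have [l [leig lann]] := symm_annihilator AT.
have l0 i : 0 < l i.
  have /eigenvalueP[v vA v0] := leig i.
  have vT0 : v^T != 0 by rewrite trmx_eq0.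
  have := Apos _ vT0; rewrite -frob_cv -{1}AT -trmx_mul vA linearZ /= frobZr.
  by rewrite pmulr_lgt0 // lt_def frob_ge0 frob_eq0 vT0.
have [q qE] := poly_interpolation (fun x => Num.sqrt (Num.sqrt x)) (codom l).
pose Q := horner_mx A q.
have QT : Q^T = Q by rewrite /Q trmx_horner AT.
have QA : (Q *m Q) *m (Q *m Q) = A.
  have : horner_mx A (q * q * (q * q) - 'X) = 0.
    apply: lann => i; rewrite !hornerE qE ?codom_f //=.
    have e1 := sqr_sqrtr (sqrtr_ge0 (l i)).
    have e2 := sqr_sqrtr (ltW (l0 i)).
    by rewrite -mulrA -!expr2 e1 e2 subrr.
  by rewrite rmorphB !rmorphM /= horner_mx_X => /eqP; rewrite subr_eq0 => /eqP.
exists (Q *m Q); split; last exact: QA.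
split; first by rewrite trmx_mul QT.
move=> v v0; rewrite -frob_cv -mulmxA -{1}QT -frob_mull.
rewrite lt_def frob_ge0 frob_eq0 andbT; apply: contraTneq v0 => Qv.
have := Apos v; rewrite -QA -!mulmxA Qv !mulmx0 -frob_cv /frob mulmx0 mxtrace0.
by case: eqVneq => // _ /(_ isT); rewrite ltxx.
Qed.

End SquareRoot.

(** * Differential inequalities on the unit interval *)

Section ScalarInequalities.
Context {R : realType}.
Implicit Types (p dp : R -> R) (a b t r : R).

Lemma mean_value p dp a b : a <= b ->
  (forall t, a <= t <= b -> is_derive t 1 p (dp t)) ->
  exists2 t, a <= t <= b & p b - p a = dp t * (b - a).
Proof.
move=> ab dpE.
have [t tab ->] : exists2 c, c \in `[a, b]%R & p b - p a = dp c * (b - a).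
  apply: MVT_segment => // [t|].
    by rewrite in_itv /= => /andP[? ?]; apply: dpE; rewrite !ltW.
  apply: derivable_within_continuous => t; rewrite in_itv /= => /dpE ?.
  exact: ex_derive.
by exists t => //; move: tab; rewrite in_itv.
Qed.

Lemma is_derive_affine K b t : is_derive t 1 (fun t => b - K * t) (- K).
Proof.
apply: (is_derive_eq (is_deriveB (is_derive_cst (b : R) (t : R) (1 : R))
  (is_deriveZ K (is_derive_id (t : R) (1 : R))))).
by rewrite /GRing.scale /= mulr1 sub0r.
Qed.

(** [p' <= 2 p^(3/2)] says that [p^(-1/2)] decreases at rate at most [1]. *)
Lemma sqrt_growth p dp r :
  (forall t, 0 <= t <= 1 -> is_derive t 1 p (dp t)) ->
  (forall t, 0 <= t <= 1 -> 0 < p t) ->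
  (forall t, 0 <= t <= 1 -> dp t <= 2 * Num.sqrt (p t) * p t) ->
  0 < r -> p 0 = r ^+ 2 ->
  forall t, 0 <= t <= 1 -> Num.sqrt (p t) * (1 - r * t) <= r.
Proof.
move=> dpE p0 dpl r0 pr t /andP[t0 t1].
have sp u : 0 <= u <= 1 -> 0 < Num.sqrt (p u) by move=> /p0; rewrite sqrtr_gt0.
have [||u /andP[u0 ut]] := @mean_value (fun u => (Num.sqrt (p u))^-1)
    (fun u => - Num.sqrt (p u) ^- 2 *: ((2 * Num.sqrt (p u))^-1 * dp u)) 0 t.
- by [].
- move=> u /andP[u0 ut]; have u01 : 0 <= u <= 1 by rewrite u0 (le_trans ut).
  apply: is_deriveV; first by rewrite gt_eqF ?sp.
  apply: is_derive1_comp; last exact: dpE.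
  exact/is_derive1_sqrt/p0.
rewrite pr sqrtr_sqr (gtr0_norm r0) subr0 => wE.
have u01 : 0 <= u <= 1 by rewrite u0 (le_trans ut).
have t01 : 0 <= t <= 1 by rewrite t0.
have := sp _ t01; have := dpl _ u01; have := sp _ u01; have := p0 _ u01.
have := sqr_sqrtr (ltW (p0 _ u01)); move: wE.
set s := Num.sqrt (p u); set q := Num.sqrt (p t) => wE s2 pu s0 dps q0.
have kl : s ^- 2 * ((2 * s)^-1 * dp u) <= 1.
  rewrite mulrA -invfM ler_pdivrMl ?mulr1; last by rewrite !mulr_gt0 ?exprn_gt0.
  by apply: le_trans dps _; rewrite le_eqVlt; apply/orP; left; apply/eqP; rewrite -s2; ring.
have wl : - t <= q^-1 - r^-1.
  by rewrite wE; have := ler_wpM2r t0 kl; rewrite /GRing.scale /=; lra.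
have iv : r * (q * (- t)) <= r * (q * (q^-1 - r^-1)).
  by rewrite ler_pM2l // ler_pM2l.
have e : r * (q * (q^-1 - r^-1)) = r - q by field; rewrite !gt_eqF.
by rewrite e in iv; lra.
Qed.

(** [p t * (1 - K * t)] is nonincreasing, which bounds [p] by
    [p 0 / (1 - K)]; the derivative is then bounded by [K] times this. *)
Lemma gronwall_bound p dp K : 0 <= K < 1 ->
  (forall t, 0 <= t <= 1 -> is_derive t 1 p (dp t)) ->
  (forall t, 0 <= t <= 1 -> 0 <= p t /\ `|dp t| <= K * p t) ->
  `|p 1 - p 0| * (1 - K) <= K * p 0.
Proof.
move=> /andP[K0 K1] dpE pK.
have up t : 0 <= t <= 1 -> p t * (1 - K) <= p 0.
  move=> /andP[t0 t1].
  have [||u /andP[u0 ut]] := @mean_value (fun u => p u * (1 - K * u))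
    (fun u => p u *: - K + (1 - K * u) *: dp u) 0 t => //.
    move=> u /andP[u0 ut].
    have u01 : 0 <= u <= 1 by rewrite u0 (le_trans ut).
    apply: is_deriveM; first exact: dpE.
    exact: is_derive_affine.
  rewrite mulr0 subr0 mulr1 => E.
  have u01 : 0 <= u <= 1 by rewrite u0 (le_trans ut).
  have [pu] := pK _ u01; rewrite ler_norml => /andP[_ hu].
  have Ku : K * u <= 1 by rewrite (le_trans (ler_wpM2l K0 (le_trans ut t1))) ?mulr1 ?ltW.
  have [pt _] : 0 <= p t /\ `|dp t| <= K * p t by apply: pK; rewrite t0.
  have h1 : (1 - K * u) * dp u <= (1 - K * u) * (K * p u).
    by rewrite ler_wpM2l // subr_ge0.
  have h2 : 0 <= K * u * (K * p u) by rewrite !mulr_ge0.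
  have h3 : p t * (1 - K * t) <= p 0.
    rewrite -subr_le0 E mulr_le0_ge0 //; rewrite /GRing.scale /=; lra.
  have h4 : p t * (K * t) <= p t * K by rewrite ler_wpM2l // ler_piMr.
  by lra.
have [u u01] := mean_value ler01 dpE.
rewrite subr0 mulr1 => ->.
have [pu hu] := pK _ u01; have := up _ u01.
have h : `|dp u| * (1 - K) <= K * p u * (1 - K) by rewrite ler_wpM2r // subr_ge0 ltW.
have : K * (p u * (1 - K)) <= K * p 0 by rewrite ler_wpM2l // up.
by lra.
Qed.

(** The constant is [2 / (1 - r)] rounded up, for [r] at most [1/100]; it turns
    the conclusion of [sqrt_growth] into the rate of [gronwall_bound]. *)
Lemma growth_rate_bound s r t : 0 <= r -> r <= 1 / 100 -> 0 <= t <= 1 ->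
  0 <= s -> s * (1 - r * t) <= r -> 2 * s <= 203 / 100 * r.
Proof.
move=> r0 r1 /andP[t0 t1] s0 h.
have h1 : s * (r * t) <= s * (1 / 100).
  by apply: ler_wpM2l => //; apply: le_trans r1; apply: ler_piMr.
by lra.
Qed.

Lemma quad_dev_bound z n r : 0 <= r -> r <= 1 / 100 -> 0 <= z -> 0 <= n ->
  z * (1 - 203 / 100 * r) <= 203 / 100 * r * n -> z <= 21 / 10 * r * n.
Proof.
move=> r0 r1 z0 n0 h.
have n1 : 0 <= r * n by exact: mulr_ge0.
have h1 : z * r <= z * (1 / 100) by exact: ler_wpM2l.
by lra.
Qed.
End ScalarInequalities.

(** * Derivatives along lines *)

Section Lines.
Context {R : realType} {d : nat}.
Implicit Types (x h u v : 'cV[R]_d) (t : R) (F : 'cV[R]_d -> R).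

Lemma is_derive_line F x h t : derivable F (x + t *: h) h ->
  is_derive t 1 (fun t => F (x + t *: h)) ('D_h F (x + t *: h)).
Proof.
have E : (fun k : R => k^-1 *: (((fun t => F (x + t *: h)) \o shift t) (k *: 1)
      - F (x + t *: h))) =
    (fun k : R => k^-1 *: ((F \o shift (x + t *: h)) (k *: h) - F (x + t *: h))).
  apply/funext => k /=; rewrite [k *: 1]mulr1 scalerDl.
  by rewrite addrCA.
by move=> dF; split; rewrite /derivable /derive E.
Qed.

Lemma cV_sum_delta v : v = \sum_i v i 0 *: delta_mx i 0.
Proof.
by rewrite [LHS]matrix_sum_delta; apply: eq_bigr => i _; rewrite big_ord1.
Qed.

Lemma derive_coord F x v : differentiable F x ->
  'D_v F x = \sum_i v i 0 * 'D_(delta_mx i 0) F x.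
Proof.
move=> dF; rewrite deriveE // [X in 'd _ _ X](cV_sum_delta v) linear_sum.
by apply: eq_bigr => i _; rewrite linearZ /= deriveE.
Qed.

Lemma dotcvE u v : dotcv u v = \sum_i u i 0 * v i 0.
Proof. by rewrite -frob_cv frobE; apply: eq_bigr => i _; rewrite big_ord1. Qed.

Lemma bilinE u (A : 'M[R]_d) v :
  dotcv u (A *m v) = \sum_i \sum_j u i 0 * v j 0 * A i j.
Proof.
rewrite dotcvE; apply: eq_bigr => i _; rewrite mxE mulr_sumr.
by apply: eq_bigr => j _; ring.
Qed.

Lemma derive_grad f x v : differentiable f x -> 'D_v f x = dotcv v (grad f x).
Proof.
move=> df; rewrite derive_coord // dotcvE.
by apply: eq_bigr => i _; rewrite mxE.
Qed.

Lemma is_derive_sumf n (g : 'I_n -> R -> R) (dg : 'I_n -> R) t :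
  (forall i, is_derive t 1 (g i) (dg i)) ->
  is_derive t 1 (fun t => \sum_i g i t) (\sum_i dg i).
Proof.
move=> H; have -> : (fun t => \sum_i g i t) = \sum_i g i.
  by apply/funext => s; rewrite fct_sumE.
exact: is_derive_sum.
Qed.

Lemma is_derive_dot u (G : R -> 'cV[R]_d) (dG : 'cV[R]_d) t :
  (forall i, is_derive t 1 (fun t => G t i 0) (dG i 0)) ->
  is_derive t 1 (fun t => dotcv u (G t)) (dotcv u dG).
Proof.
move=> H; under eq_fun do rewrite dotcvE; rewrite dotcvE.
by apply: is_derive_sumf => i; exact: is_deriveZ.
Qed.

Lemma is_derive_bilin u v (G : R -> 'M[R]_d) (dG : 'M[R]_d) t :
  (forall i j, is_derive t 1 (fun t => G t i j) (dG i j)) ->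
  is_derive t 1 (fun t => dotcv u (G t *m v)) (dotcv u (dG *m v)).
Proof.
move=> H; under eq_fun do rewrite bilinE; rewrite bilinE.
by do 2!apply: is_derive_sumf => ?; exact: is_deriveZ.
Qed.

End Lines.

Definition dhess (R : realType) (d : nat) (f : 'cV[R]_d -> R) (h x : 'cV[R]_d) :=
  \matrix_(i, j) 'D_h (fun x => hess f x i j) x.

Section SelfConcordantCalculus.
Context {R : realType} {d : nat} (D : set 'cV[R]_d) (f : 'cV[R]_d -> R).
Context (f_sc : self_concordant D f).
Implicit Types (x h u v : 'cV[R]_d) (t : R).

Lemma sc_diff x : D x -> differentiable f x.
Proof. by move=> Dx; have [/(_ x (mem_set Dx))] := sc_C3 f_sc. Qed.

Lemma sc_diff2 v x : D x -> differentiable ('D_v f) x.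
Proof. by move=> Dx; have [_ /(_ v)[/(_ x (mem_set Dx))]] := sc_C3 f_sc. Qed.

Lemma sc_diff3 v w x : D x -> differentiable ('D_w ('D_v f)) x.
Proof.
by move=> Dx; have [_ /(_ v)[_ /(_ w)[/(_ x (mem_set Dx))]]] := sc_C3 f_sc.
Qed.

Lemma sc_diff_hess x i j : D x -> differentiable (fun x => hess f x i j) x.
Proof. by move=> Dx; under eq_fun do rewrite mxE; exact: sc_diff3. Qed.

Lemma hess_tr x : D x -> (hess f x)^T = hess f x.
Proof. by move=> Dx; have [] := sc_hess f_sc (mem_set Dx). Qed.

Lemma hess_pos x u : D x -> u != 0 -> 0 < dotcv u (hess f x *m u).
Proof. by move=> Dx; have [_] := sc_hess f_sc (mem_set Dx); exact. Qed.

Lemma hess_ge0 x u : D x -> 0 <= dotcv u (hess f x *m u).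
Proof.
move=> Dx; have [->|u0] := eqVneq u 0; last exact/ltW/hess_pos.
by rewrite mulmx0 -frob_cv /frob mulmx0 mxtrace0.
Qed.

Lemma is_derive_f x h t : D (x + t *: h) ->
  is_derive t 1 (fun t => f (x + t *: h)) (dotcv h (grad f (x + t *: h))).
Proof.
move=> Dx; rewrite -derive_grad; last exact: sc_diff.
exact/is_derive_line/diff_derivable/sc_diff.
Qed.

Lemma is_derive_grad u x h t : D (x + t *: h) ->
  is_derive t 1 (fun t => dotcv u (grad f (x + t *: h)))
                (dotcv u (hess f (x + t *: h) *m h)).
Proof.
move=> Dx; apply: is_derive_dot => j; under eq_fun do rewrite mxE.
have -> : (hess f (x + t *: h) *m h) j 0 =
          'D_h ('D_(delta_mx j 0) f) (x + t *: h).
  rewrite derive_coord; last exact: sc_diff2.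
  rewrite -hess_tr // mxE; apply: eq_bigr => i _.
  by rewrite !mxE mulrC.
exact/is_derive_line/diff_derivable/sc_diff2.
Qed.

Lemma is_derive_hess u v x h t : D (x + t *: h) ->
  is_derive t 1 (fun t => dotcv u (hess f (x + t *: h) *m v))
                (dotcv u (dhess f h (x + t *: h) *m v)).
Proof.
move=> Dx; apply: is_derive_bilin => i j; rewrite [dhess _ _ _ _ _]mxE.
exact/is_derive_line/diff_derivable/sc_diff_hess.
Qed.

Lemma dhess_le x h u : D x -> dotcv u (dhess f h x *m u) <=
  2 * Num.sqrt (dotcv h (hess f x *m h)) * dotcv u (hess f x *m u).
Proof.
move=> Dx; have [_ /(_ u)] := sc_third f_sc (mem_set Dx) h.
have Dx0 : D (x + 0 *: h) by rewrite scale0r addr0.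
have dE i j : is_derive (0 : R) 1 (fun t : R => hess f (x + t *: h) i j)
                 ('D_h (fun x => hess f x i j) (x + 0 *: h)).
  exact/is_derive_line/diff_derivable/sc_diff_hess.
have -> : derive1 (fun t : R => hess f (x + t *: h)) 0 = dhess f h x.
  rewrite derive1E derive_mx; last first.
    by apply/derivable_mxP => i j; apply: ex_derive.
  apply/matrixP => i j; rewrite [LHS]mxE [RHS]mxE.
  have e := @derive_val _ _ _ _ _ _ _ (dE i j); rewrite scale0r addr0 in e.
  exact: e.
rewrite mulmxBl -!frob_cv frobDr frobNr -scalemxAl frobZr subr_ge0.
by [].
Qed.

(** The third-order condition bounds the derivative of the Hessian from above
    only; in the direction [- h] it gives the lower bound. *)
Lemma dhess_norm_le x h u : D x -> `|dotcv u (dhess f h x *m u)| <=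
  2 * Num.sqrt (dotcv h (hess f x *m h)) * dotcv u (hess f x *m u).
Proof.
move=> Dx; rewrite ler_norml dhess_le // andbT lerNl.
have -> : - dotcv u (dhess f h x *m u) = dotcv u (dhess f (- h) x *m u).
  have -> : dhess f (- h) x = - dhess f h x.
    apply/matrixP => i j; have dij := sc_diff_hess i j Dx.
    by rewrite !mxE !deriveE // linearN.
  by rewrite mulNmx -!frob_cv frobNr.
have -> : dotcv h (hess f x *m h) = dotcv (- h) (hess f x *m - h).
  by rewrite mulmxN -!frob_cv frobNl frobNr opprK.
exact: dhess_le.
Qed.

End SelfConcordantCalculus.

(** * The geometry of a self-concordant function near its minimizer *)

Section Polarization.
Context {R : realType} {d : nat}.
Implicit Types (A B E S : 'M[R]_d) (u v : 'cV[R]_d).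

Lemma dotcv_subM A B u v :
  dotcv u (A *m v) - dotcv u (B *m v) = frob u ((A - B) *m v).
Proof. by rewrite mulmxBl !frob_lin !frob_cv. Qed.

Lemma symm_subM A B : A^T = A -> B^T = B -> (A - B)^T = A - B.
Proof. by move=> AT BT; rewrite linearB /= AT BT. Qed.

(** Polarization turns the bound on quadratic forms into one on the bilinear
    form, i.e. on the operator norm relative to the norm [|S u|]. *)
Lemma polar_bound E S (k : R) u v : E^T = E ->
  (forall u, S *m u = 0 -> u = 0) -> 0 <= k ->
  (forall u, `|frob u (E *m u)| <= k * fnorm (S *m u) ^+ 2) ->
  `|frob u (E *m v)| <= k * (fnorm (S *m u) * fnorm (S *m v)).
Proof.
move=> ET S0 k0 Eq.
have pol (a b : 'cV[R]_d) : `|frob a (E *m b)|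
    <= k * ((frob (S *m a) (S *m a) + frob (S *m b) (S *m b)) / 2).
  have e4 : frob a (E *m b) =
      (frob (a + b) (E *m (a + b)) - frob (a - b) (E *m (a - b))) / 4.
    rewrite mulmxDr mulmxBr !frob_lin (symm_frob b a ET).
    by rewrite (frobC (E *m b)); field.
  have := Eq (a + b); have := Eq (a - b); rewrite e4 !sqr_fnorm.
  move: (frob (a + b) _) (frob (a - b) _) => p q.
  rewrite !mulmxDr !mulmxN !frob_lin (frobC (S *m b) (S *m a)).
  rewrite !ler_norml => /andP[h1 h1'] /andP[h2 h2'].
  by apply/andP; split; lra.
have [Su|] := eqVneq (S *m u) 0.
  rewrite (S0 _ Su) mulmx0 fnorm0 mul0r mulr0 frobC /frob mulmx0 mxtrace0.
  by rewrite normr0.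
have [Sv|] := eqVneq (S *m v) 0.
  by rewrite (S0 _ Sv) !mulmx0 fnorm0 !mulr0 /frob mulmx0 mxtrace0 normr0.
(* Rescaling equalizes the two norms, which makes the mean a product. *)
rewrite -!fnorm_gt0; have := pol (fnorm (S *m v) *: u) (fnorm (S *m u) *: v).
rewrite -!scalemxAr !frob_lin -!sqr_fnorm.
move: (fnorm (S *m u)) (fnorm (S *m v)) => p q.
move=> + q0 p0; rewrite mulrA normrM gtr0_norm ?mulr_gt0 // => h.
have e : k * ((q * (q * p ^+ 2) + p * (p * q ^+ 2)) / 2) = q * p * (k * (p * q)).
  by field.
by rewrite e ler_pM2l ?mulr_gt0 in h.
Qed.

End Polarization.

#[local] Opaque hess grad dhess.

Section LocalGeometry.
Context {R : realType} {d : nat} (D : set 'cV[R]_d) (f : 'cV[R]_d -> R).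
Context (xs : 'cV[R]_d) (S T : 'M[R]_d).
Context (f_sc : self_concordant D f).
Context (xs_min : minimizer D f xs).
Context (S_tr : S^T = S).
Context (T_tr : T^T = T).
Context (SS : S *m S = hess f xs).
Context (ST : S *m T = 1%:M).
Implicit Types (x h u v : 'cV[R]_d) (t : R).

Let ldist x := fnorm (S *m (x - xs)).

Let TS : T *m S = 1%:M. Proof. exact: mulmx1C. Qed.

Let Dxs : D xs. Proof. by have [/set_mem] := xs_min. Qed.

Lemma hess_frob u v : dotcv u (hess f xs *m v) = frob (S *m u) (S *m v).
Proof. by rewrite -SS -frob_cv [in RHS]frob_mull S_tr mulmxA. Qed.

Lemma hess_fnorm u : dotcv u (hess f xs *m u) = fnorm (S *m u) ^+ 2.
Proof. by rewrite hess_frob sqr_fnorm. Qed.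

Lemma mulS_eq0 u : (S *m u == 0) = (u == 0).
Proof.
apply/eqP/eqP => [Su|->]; last by rewrite mulmx0.
by rewrite -[u]mul1mx -TS -mulmxA Su mulmx0.
Qed.

Lemma convex_line x y t : D x -> D y -> 0 <= t <= 1 -> D (x + t *: (y - x)).
Proof.
move=> Dx Dy /andP[t0 t1].
have := sc_convex f_sc (Itv01 t0 t1) (mem_set Dy) (mem_set Dx).
move/set_mem; rewrite /conv /= /unstable.onem.
have -> // : x + t *: (y - x) = t *: y + (1 - t) *: x.
by rewrite scalerBl scale1r scalerBr addrCA.
Qed.

(** Along the segment from the minimizer to [x] the local length of the
    direction exceeds [ldist x] only slightly, by [sqrt_growth]. The form
    [<u, hess f u>] thus satisfies a linear differential inequality with a rate
    proportional to [ldist x]. *)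
Lemma hess_quad_close x u : D x -> ldist x <= 1 / 100 ->
  `|dotcv u (hess f x *m u) - dotcv u (hess f xs *m u)|
    <= 21 / 10 * ldist x * dotcv u (hess f xs *m u).
Proof.
move=> Dx; rewrite /ldist; set r := fnorm _ => r1.
have r00 : 0 <= r := fnorm_ge0 _.
have [xE|h0] := eqVneq (x - xs) 0.
  have -> : x = xs by apply/eqP; rewrite -subr_eq0 xE.
  by rewrite subrr normr0; apply: mulr_ge0; [lra|exact: (hess_ge0 f_sc)].
have r0 : 0 < r by rewrite fnorm_gt0 mulS_eq0.
have Dl t : 0 <= t <= 1 -> D (xs + t *: (x - xs)) by exact: convex_line.
have sq : forall t, 0 <= t <= 1 ->
    Num.sqrt (dotcv (x - xs) (hess f (xs + t *: (x - xs)) *m (x - xs)))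
      * (1 - r * t) <= r.
  apply: (sqrt_growth (dp := fun t => dotcv (x - xs)
      (dhess f (x - xs) (xs + t *: (x - xs)) *m (x - xs)))) => //.
  - by move=> t /Dl Dt; exact: (is_derive_hess f_sc).
  - by move=> t /Dl Dt; exact: (hess_pos f_sc).
  - by move=> t /Dl Dt; exact: (dhess_le f_sc).
  - by rewrite scale0r addr0 hess_fnorm.
have K01 : 0 <= 203 / 100 * r < 1 by apply/andP; split; lra.
have e1 : xs + 1 *: (x - xs) = x by rewrite scale1r addrC subrK.
have e0 : xs + 0 *: (x - xs) = xs by rewrite scale0r addr0.
pose p t := dotcv u (hess f (xs + t *: (x - xs)) *m u).
have p1 : p 1 = dotcv u (hess f x *m u).
  exact: (congr1 (fun y => dotcv u (hess f y *m u)) e1).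
have p0 : p 0 = dotcv u (hess f xs *m u).
  exact: (congr1 (fun y => dotcv u (hess f y *m u)) e0).
have H : `|p 1 - p 0| * (1 - 203 / 100 * r) <= 203 / 100 * r * p 0.
  apply: (@gronwall_bound R p
    (fun t => dotcv u (dhess f (x - xs) (xs + t *: (x - xs)) *m u)) _ K01).
    by move=> t /Dl Dt; exact: (is_derive_hess f_sc).
  move=> t t01; have Dt := Dl _ t01; split; first exact: (hess_ge0 f_sc).
  apply: le_trans (dhess_norm_le f_sc _ _ Dt) _.
  rewrite /p; apply: ler_wpM2r; first exact: (hess_ge0 f_sc).
  exact: growth_rate_bound r00 r1 t01 (sqrtr_ge0 _) (sq _ t01).
rewrite p1 p0 in H.
exact: quad_dev_bound r00 r1 (normr_ge0 _) (hess_ge0 f_sc u Dxs) H.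
Qed.

Lemma hess_bilin_close x u v : D x -> ldist x <= 1 / 100 ->
  `|dotcv u (hess f x *m v) - dotcv u (hess f xs *m v)|
    <= 21 / 10 * ldist x * (fnorm (S *m u) * fnorm (S *m v)).
Proof.
move=> Dx x1; rewrite dotcv_subM; apply: polar_bound.
- exact: (symm_subM (hess_tr f_sc Dx) (hess_tr f_sc Dxs)).
- by move=> a /eqP; rewrite mulS_eq0 => /eqP.
- by apply: mulr_ge0; [lra|exact: fnorm_ge0].
- by move=> a; rewrite -dotcv_subM -hess_fnorm; exact: hess_quad_close.
Qed.

Lemma ldist_line x y t m : 0 <= t <= 1 -> ldist x <= m -> ldist y <= m ->
  ldist (x + t *: (y - x)) <= m.
Proof.
move=> /andP[t0 t1] xm ym; rewrite /ldist.
have -> : x + t *: (y - x) - xs = (1 - t) *: (x - xs) + t *: (y - xs).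
  by apply/matrixP => i j; rewrite !mxE; ring.
rewrite mulmxDr -!scalemxAr; apply: le_trans (fnormD _ _) _.
rewrite !fnormZ !ger0_norm ?subr_ge0 //.
have := ler_wpM2l t0 ym; have t1' : 0 <= 1 - t by lra.
by have := ler_wpM2l t1' xm; rewrite /ldist; lra.
Qed.

(** In the local metric the gradient is the identity up to a relative error
    proportional to the distance to the minimizer. *)
Lemma grad_diff_close x y m : D x -> D y -> m <= 1 / 100 ->
  ldist x <= m -> ldist y <= m ->
  fnorm (T *m (grad f y - grad f x) - S *m (y - x))
    <= 21 / 10 * m * fnorm (S *m (y - x)).
Proof.
move=> Dx Dy m1 xm ym.
set z := T *m _ - _; set s := S *m (y - x).
have m0 : 0 <= m := le_trans (fnorm_ge0 _) xm.
have zE u : frob u (T *m (grad f y - grad f x) - S *m (y - x)) =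
   dotcv (T *m u) (grad f y - grad f x) - dotcv (T *m u) (hess f xs *m (y - x)).
  by rewrite hess_frob !mulmxA ST mul1mx -frob_cv [in RHS]frob_mull T_tr !frob_lin.
have Dl t : 0 <= t <= 1 -> D (x + t *: (y - x)) by exact: convex_line.
have bnd : frob z z <= 21 / 10 * m * (fnorm z * fnorm s).
  rewrite {2}/z zE; set u := T *m z.
  have Suz : S *m u = z by rewrite /u mulmxA ST mul1mx.
  have [||t t01] := @mean_value R
    (fun t => dotcv u (grad f (x + t *: (y - x))))
    (fun t => dotcv u (hess f (x + t *: (y - x)) *m (y - x))) 0 1 => //.
    by move=> t /Dl Dt; exact: (is_derive_grad f_sc).
  rewrite scale1r scale0r addr0 [x + _]addrC subrK subr0 mulr1 => e.
  have -> : dotcv u (grad f y - grad f x) = dotcv u (grad f y) - dotcv u (grad f x).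
    by rewrite -!frob_cv !frob_lin.
  rewrite e; apply: le_trans (ler_norm _) _.
  have lt := ldist_line t01 xm ym.
  apply: le_trans (hess_bilin_close _ _ (Dl _ t01) (le_trans lt m1)) _.
  rewrite Suz ler_wpM2r ?mulr_ge0 ?fnorm_ge0 // ler_wpM2l //.
have [->|z0] := eqVneq z 0; first by rewrite fnorm0 !mulr_ge0 ?fnorm_ge0.
have z0' : 0 < fnorm z by rewrite fnorm_gt0.
by rewrite -(ler_pM2l z0') -expr2 sqr_fnorm mulrCA.
Qed.

(** The domain is open, so along each coordinate line [xs] is an interior
    minimum. *)
Lemma grad_min : grad f xs = 0.
Proof.
apply/colP => i; rewrite !mxE; set e := delta_mx i 0.
have /nbhs_ballP[r /= r0 rD] : nbhs (0 : R) [set t : R | D (xs + t *: e)].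
  have ct : {for (0 : R), continuous (fun t : R => xs + t *: e)}.
    apply: cvgD; first exact: cvg_cst.
    by apply: cvgZr_tmp; exact: cvg_id.
  apply: ct; rewrite scale0r addr0.
  exact: open_nbhs_nbhs (conj (sc_open f_sc) Dxs).
have in_ t : t \in `](- r), r[%R -> D (xs + t *: e).
  rewrite in_itv /= => /andP[t1 t2]; apply: rD.
  by rewrite /ball /= sub0r normrN ltr_norml t1.
have D0 : D (xs + 0 *: e) by rewrite scale0r addr0.
have : is_derive (0 : R) 1 (fun t => f (xs + t *: e)) 0.
  apply: (@derive1_at_min R _ (- r) r).
  - by rewrite ge0_cp // ltW.
  - by move=> t /in_ Dt; apply: ex_derive; exact: (is_derive_f f_sc).
  - by rewrite in_itv /= oppr_lt0 r0.
  - move=> t /in_ Dt; rewrite scale0r addr0.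
    by have [_] := xs_min; apply; apply: mem_set.
move/(@derive_val _ _ _ _ _ _ _).
have := @derive_val _ _ _ _ _ _ _
  (is_derive_line (diff_derivable (sc_diff f_sc D0))).
by move=> -> ; rewrite scale0r addr0.
Qed.

(** The mean value theorem for [f] minus the quadratic [ldist x ^+ 2 / 2 * t^2]
    along the segment: the derivative of the difference is the deviation of the
    gradient from the identity, paired with the direction. *)
Lemma f_close x : D x -> ldist x <= 1 / 100 ->
  `|f x - f xs - ldist x ^+ 2 / 2| <= 21 / 10 * ldist x ^+ 3.
Proof.
move=> Dx; rewrite /ldist; set r := fnorm _ => r1.
have r0 : 0 <= r := fnorm_ge0 _.
have Dl t : 0 <= t <= 1 -> D (xs + t *: (x - xs)) by exact: convex_line.
have [||t t01] := @mean_value R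
    (fun t => f (xs + t *: (x - xs)) - r ^+ 2 / 2 * (t * t))
    (fun t => dotcv (x - xs) (grad f (xs + t *: (x - xs))) - r ^+ 2 * t) 0 1 => //.
  move=> t /Dl Dt; apply: is_deriveB; first exact: (is_derive_f f_sc).
  apply: (is_derive_eq (is_deriveZ (r ^+ 2 / 2)
    (is_deriveM (is_derive_id (t : R) (1 : R)) (is_derive_id (t : R) (1 : R))))).
  by rewrite /GRing.scale /=; field.
rewrite scale1r scale0r addr0 [xs + _]addrC subrK !mulr0 !subr0 !mulr1.
have -> : f x - r ^+ 2 / 2 - f xs = f x - f xs - r ^+ 2 / 2 by ring.
move=> ->.
set y := xs + _.
have yx : y - xs = t *: (x - xs) by rewrite /y addrC addKr.
have yr : ldist y <= r.
  rewrite /y; apply: ldist_line => //.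
  by rewrite /ldist subrr mulmx0 fnorm0.
have := grad_diff_close Dxs (Dl _ t01) r1.
rewrite grad_min subr0 -/y /ldist yx subrr mulmx0 fnorm0.
rewrite /ldist yx in yr; move=> /(_ r0 yr) H.
have -> : dotcv (x - xs) (grad f y) - r ^+ 2 * t =
    frob (S *m (x - xs)) (T *m grad f y - S *m (t *: (x - xs))).
  rewrite frob_lin frobNr -scalemxAr frobZr -sqr_fnorm -/r -frob_cv.
  by rewrite frob_mull S_tr mulmxA ST mul1mx [t * _]mulrC.
apply: le_trans (frob_CS _ _) _; rewrite -/r.
have := ler_wpM2l r0 H; rewrite -scalemxAr fnormZ -/r.
move: t01 => /andP[t0 t1]; rewrite ger0_norm // => h.
have : t * r ^+ 3 <= r ^+ 3 by rewrite ler_piMl // exprn_ge0.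
by lra.
Qed.

(** Along a segment leaving the minimizer, [f] stays bounded as long as the
    segment stays in the domain and in the local ball; since the epigraph is
    closed, the segment can therefore not reach the boundary of the domain. *)
Lemma local_ball_dom x : ldist x <= 1 / 100 -> D x.
Proof.
move=> x1; set r := ldist x in x1; have r0 : 0 <= r := fnorm_ge0 _.
pose g (t : R) := xs + t *: (x - xs).
have gc : continuous g.
  move=> t; apply: cvgD; first exact: cvg_cst.
  by apply: cvgZr_tmp; exact: cvg_id.
pose C := [set t : R | D (g t) /\ f (g t) <= f xs + 1].
have Ccl : closed C.
  have -> : C = (fun t => (g t, f xs + 1)) @^-1`
      [set p : 'cV[R]_d * R | D p.1 /\ f p.1 <= p.2] by [].
  apply: closed_comp => [t _|]; last exact: sc_closed f_sc.
  have cc : (fun _ : R => f xs + 1) x @[x --> t] --> f xs + 1 by exact: cvg_cst.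
  exact: (cvg_pair (gc t) cc).
have Oop : open (g @^-1` D).
  by apply: open_comp => [t _|]; [exact: gc|exact: sc_open f_sc].
have gle t : 0 <= t <= 1 -> D (g t) -> f (g t) <= f xs + 1.
  move=> t01 Dg; have l1 : ldist (g t) <= r.
    by apply: ldist_line => //; rewrite /ldist subrr mulmx0 fnorm0.
  have := f_close Dg (le_trans l1 x1); rewrite ler_norml => /andP[_ h].
  have l0 : 0 <= ldist (g t) by exact: fnorm_ge0.
  move: (ldist (g t)) (le_trans l1 x1) l0 h => l lx l0 h.
  have l2 : l * l <= l * (1 / 100) by exact: ler_wpM2l.
  have l3 : l * (l * l) <= l * (l * (1 / 100)) by exact: ler_wpM2l.
  by lra.
have H : `[0, 1] `&` (g @^-1` D) = `[0, 1]%classic.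
  apply: segment_connected.
  - exists 0; split; first by rewrite /= in_itv /= lexx ler01.
    by rewrite /= /g scale0r addr0.
  - by exists (g @^-1` D).
  - exists C => //; apply/seteqP; split => t /= [t01 Dt]; split => //.
      by split => //; apply: gle.
    by case: Dt.
have : (`[0, 1]%classic : set R) 1 by rewrite /= in_itv /= lexx ler01.
by rewrite -H => -[_] /=; rewrite /g scale1r addrC subrK.
Qed.

End LocalGeometry.

(** * Convergence of the iterates *)

Section Rates.
Context {R : realType}.

(** The factors [P k - P k.+1] telescope to a sum of at most [1], so by the
    inequality between the arithmetic and the geometric mean the product of the
    first [k] of them is at most [(1/k)^k]. *)
Lemma superlinear_of_potential (a P : nat -> R) : (forall k, 0 <= a k) ->
  (forall k, 0 <= P k) -> P 0%N <= 1 -> (forall k, P k.+1 <= P k) ->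
  (forall k, a k.+1 <= (P k - P k.+1) * a k) ->
  forall k, (1 <= k)%N -> a k <= (1 / k%:R) ^+ k * a 0%N.
Proof.
move=> a0 P0 P1 Pd ak k k1.
have z0 i : 0 <= P i - P i.+1 by rewrite subr_ge0.
have prod : a k <= \prod_(i < k) (P i - P i.+1) * a 0%N.
  elim: k {k1} => [|k IH]; first by rewrite big_ord0 mul1r.
  rewrite big_ord_recr /= mulrAC mulrC; apply: le_trans (ak k) _.
  exact: ler_wpM2l.
apply: le_trans prod _; apply: ler_wpM2r => //.
have [agm _] := @leif_AGM R 'I_k predT (fun i => P i - P i.+1) (fun i _ => z0 i).
apply: le_trans agm _; rewrite cardT size_enum_ord.
have -> : \sum_(i < k) (P i - P i.+1) = P 0%N - P k.
  elim: k {k1} => [|k IH]; first by rewrite big_ord0 subrr.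
  by rewrite big_ord_recr /= IH addrA subrK.
have k0 : 0 < k%:R :> R by rewrite ltr0n.
apply: lerXn2r; rewrite ?nnegrE.
- apply: divr_ge0; last exact: ltW.
  by rewrite subr_ge0; elim: k {k1 k0} => // k; exact: le_trans.
- by apply: divr_ge0 => //; exact: ltW.
- by rewrite ler_pM2r ?invr_gt0 //; have := P0 k; lra.
Qed.

(** The secant error [c] shrinks by a factor [3] in each step, so adding a
    multiple of [c] absorbs its contribution: with [6 * c] the error bound [e]
    itself becomes monotone, with [3 * c] its square does. The latter decreases
    by at least a multiple of [th ^+ 2 + c ^+ 2], which bounds the squared
    contraction factor of the step. *)
Lemma potential_decrease (e e' g th c c' : R) : 0 <= e' -> e <= 1 / 5 ->
  0 <= e -> 0 <= c -> c <= 7 / 1000 -> 0 <= g -> g ^+ 2 <= e ^+ 2 - th ^+ 2 / 2 ->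
  e' <= g + 4 * c -> c' <= c / 3 ->
  e' + 6 * c' <= e + 6 * c /\
  37 / 10 * (th ^+ 2 + c ^+ 2) <=
    8 * (e ^+ 2 + 3 * c) - 8 * (e' ^+ 2 + 3 * c').
Proof.
move=> e'0 e5 e0 c0 c7 g0 ge e'g cc.
have th0 := sqr_ge0 th.
have ge' : g <= e by rewrite -ler_sqr ?nnegrE //; lra.
split; first by lra.
have h : e' ^+ 2 <= (g + 4 * c) ^+ 2 by rewrite ler_sqr ?nnegrE //; lra.
have h1 : c * g <= c * (1 / 5) by apply: ler_wpM2l => //; lra.
have h2 : c * c <= c * (7 / 1000) by exact: ler_wpM2l.
by lra.
Qed.

End Rates.

Section Steps.
Context {R : realType} {d : nat}.
Implicit Types (B E : 'M[R]_d) (r s g y v : 'cV[R]_d).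

Lemma unitmx_inj B : (forall v, B *m v = 0 -> v = 0) -> B \in unitmx.
Proof.
move=> Binj; rewrite -unitmx_tr unitmxE unitfE; apply/negP => /det0P[v v0 vB].
have /Binj vT : B *m v^T = 0 by rewrite -[B]trmxK -trmx_mul vB trmx0.
by move: v0; rewrite -trmx_eq0 vT eqxx.
Qed.

Lemma near_id_unit B : fnorm (B - 1%:M) <= 1 / 5 -> B \in unitmx.
Proof.
move=> Be; apply: unitmx_inj => v Bv; apply/eqP; rewrite -fnorm_eq0.
have := fnormM (B - 1%:M) v; rewrite mulmxBl Bv mul1mx sub0r fnormN => h.
have := fnorm_ge0 v; rewrite le_eqVlt => /predU1P[<-//|v0].
have := ler_wpM2r (ltW v0) Be; lra.
Qed.

(** Both [B - 1] and the gradient's deviation from the identity are small, so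
    the quasi-Newton step is nearly the exact step [- r]. *)
Lemma linear_step B r r' g (c : R) : fnorm (B - 1%:M) <= 1 / 5 ->
  c <= 7 / 1000 -> fnorm (g - r) <= c * fnorm r -> B *m (r' - r) = - g ->
  fnorm r' <= fnorm r / 3.
Proof.
move=> Be c1 gr Bs; set E := B - 1%:M in Be.
have rE : r' = E *m r - E *m r' - (g - r).
  have := Bs; rewrite -[B](subrK 1%:M) -/E mulmxDl mul1mx mulmxBr => h.
  by rewrite opprB -[X in _ + (r - X)]opprK -h; apply/matrixP => i j; rewrite !mxE; ring.
have h1 := fnormB (E *m r - E *m r') (g - r).
have h2 := fnormB (E *m r) (E *m r').
have h3 := fnormM E r; have h4 := fnormM E r'.
have h5 := ler_wpM2r (fnorm_ge0 r) Be; have h6 := ler_wpM2r (fnorm_ge0 r') Be.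
have h7 := ler_wpM2r (fnorm_ge0 r) c1.
have := fnorm_ge0 r; have := fnorm_ge0 r'.
rewrite -rE in h1; lra.
Qed.

(** The new gradient is [- E s] up to the secant error, so the contraction
    factor of a step is governed by the relative size of [E s]. *)
Lemma superlinear_step B r r' g g' (c : R) : 0 <= c -> c <= 7 / 1000 ->
  r' - r != 0 -> B *m (r' - r) = - g -> fnorm r' <= fnorm r / 3 ->
  fnorm (g' - r') <= c * fnorm r' ->
  fnorm (g' - g - (r' - r)) <= c * fnorm (r' - r) ->
  fnorm r' ^+ 2 <= 37 / 10 *
    ((fnorm ((B - 1%:M) *m (r' - r)) / fnorm (r' - r)) ^+ 2 + c ^+ 2)
    * fnorm r ^+ 2.
Proof.
move=> c0 c1 s0 Bs r3 gr' yc; set E := B - 1%:M; set s := r' - r in Bs s0 yc *.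
have sn : 0 < fnorm s by rewrite fnorm_gt0.
set th := fnorm (E *m s) / fnorm s.
have th0 : 0 <= th by rewrite divr_ge0 ?fnorm_ge0.
have Es : fnorm (E *m s) = th * fnorm s by rewrite divfK // gt_eqF.
have gE : g' = (g' - g - s) - E *m s.
  rewrite mulmxBl mul1mx Bs; apply/matrixP => i j; rewrite !mxE; ring.
have h1 := fnormB (g' - g - s) (E *m s); rewrite -gE Es in h1.
have h2 := fnormB r' r; rewrite -/s in h2.
have h3 : fnorm r' <= fnorm g' + fnorm (g' - r').
  by rewrite -{1}[r'](subKr g') fnormB.
have h4 : c * fnorm r' <= 7 / 1000 * fnorm r' by apply: ler_wpM2r => //; exact: fnorm_ge0.
have h5 : (th + c) * fnorm s <= (th + c) * (4 / 3 * fnorm r).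
  by apply: ler_wpM2l; [exact: addr_ge0|lra].
have r0 := fnorm_ge0 r; have r'0 := fnorm_ge0 r'.
have h6 : fnorm r' <= 27 / 20 * ((th + c) * fnorm r) by lra.
have h7 : fnorm r' ^+ 2 <= (27 / 20 * ((th + c) * fnorm r)) ^+ 2.
  by rewrite ler_sqr ?nnegrE // !mulr_ge0 ?addr_ge0.
apply: le_trans h7 _.
have -> : (27 / 20 * ((th + c) * fnorm r)) ^+ 2
    = 729 / 400 * (th + c) ^+ 2 * fnorm r ^+ 2 by field.
apply: ler_wpM2r; first exact: sqr_ge0.
have := sqr_ge0 (th - c); have := sqr_ge0 th; have := sqr_ge0 c; lra.
Qed.

End Steps.

Section Iteration.
Context {R : realType} {d : nat} (D : set 'cV[R]_d) (f : 'cV[R]_d -> R).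
Context (xs : 'cV[R]_d) (S T : 'M[R]_d).
Context (f_sc : self_concordant D f).
Context (xs_min : minimizer D f xs).
Context (S_tr : S^T = S).
Context (T_tr : T^T = T).
Context (SS : S *m S = hess f xs).
Context (ST : S *m T = 1%:M).
Context (upd : 'M[R]_d -> 'cV[R]_d -> 'cV[R]_d -> 'M[R]_d).
Context (upd_corrects : self_correcting upd).
Context (upd_equiv : congruence_equivariant upd).
Context (x : nat -> 'cV[R]_d) (B : nat -> 'M[R]_d).
Context (B0_tr : (B 0%N)^T = B 0%N).
Context (qn : quasi_newton upd f x B).
Context (steps : forall k, x k.+1 - x k != 0).
Context (x0_close : fnorm (S *m (x 0%N - xs)) <= 1 / 300).
Context (B0_close : fnorm (T *m (B 0%N - hess f xs) *m T) <= 1 / 7).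

Let TS : T *m S = 1%:M. Proof. exact: mulmx1C. Qed.

Let Dxs : D xs. Proof. by have [/set_mem] := xs_min. Qed.

Let r k := S *m (x k - xs).
Let g k := T *m grad f (x k).
Let Bh k := T *m B k *m T.
Let c k := 21 / 10 * fnorm (r k).
Let e k := fnorm (Bh k - 1%:M).

(** The bound [1/5] on [e k] is the range in which one update is
    self-correcting; [6 * c k] is what the remaining steps can still add. *)
Let inv k := [/\ (Bh k)^T = Bh k, fnorm (r k) <= 1 / 300 &
  e k + 6 * c k <= 1 / 5].

Let inv0 : inv 0%N.
Proof.
split => //; first by rewrite /Bh !trmx_mul T_tr B0_tr mulmxA.
have E : Bh 0%N - 1%:M = T *m (B 0%N - hess f xs) *m T.
  rewrite mulmxBr mulmxBl -SS; congr (_ - _).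
  by rewrite mulmxA TS mul1mx ST.
by move: x0_close B0_close; rewrite /e /c E -/(r 0%N); lra.
Qed.

Let s_r k : S *m (x k.+1 - x k) = r k.+1 - r k.
Proof. by rewrite /r -mulmxBr opprB addrA subrK. Qed.

Let s_neq0 k : r k.+1 - r k != 0.
Proof. by rewrite -s_r (mulS_eq0 ST) steps. Qed.

Let P k := 8 * (e k ^+ 2 + 3 * c k).

Let step k : inv k -> [/\ inv k.+1, P k.+1 <= P k &
  fnorm (r k.+1) ^+ 2 <= (P k - P k.+1) * fnorm (r k) ^+ 2].
Proof.
move=> [BT r300 ec].
have r0 := fnorm_ge0 (r k).
have c0 : 0 <= c k by rewrite /c; lra.
have c7 : c k <= 7 / 1000 by rewrite /c; lra.
have e0 : 0 <= e k by exact: fnorm_ge0.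
have e5 : e k <= 1 / 5 by lra.
have Bu : B k \in unitmx.
  have Bhu := near_id_unit e5.
  have Su : S \in unitmx by case: (mulmx1_unit ST).
  suff -> : B k = S *m Bh k *m S by rewrite unitmx_mul (unitmx_mul S) Su Bhu.
  by rewrite /Bh !mulmxA ST mul1mx -mulmxA TS mulmx1.
have [xE BE] := qn k.
have Bs : Bh k *m (r k.+1 - r k) = - g k.
  rewrite -s_r /Bh -!mulmxA (mulmxA T S) TS mul1mx xE addrAC subrr sub0r.
  by rewrite mulmxN mulKVmx // mulmxN.
have near_dom j : fnorm (r j) <= 1 / 300 -> D (x j).
  move=> h; apply: (local_ball_dom f_sc xs_min S_tr T_tr SS ST).
  by apply: le_trans h _; lra.
have gr j : fnorm (r j) <= 1 / 300 ->
    fnorm (g j - r j) <= 21 / 10 * fnorm (r j) * fnorm (r j).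
  move=> h; have := @grad_diff_close _ _ _ _ _ _ _ f_sc xs_min S_tr T_tr
    SS ST xs (x j) (fnorm (r j)) Dxs (near_dom _ h).
  rewrite (grad_min f_sc xs_min) subr0 subrr mulmx0 fnorm0; apply => //.
    by apply: le_trans h _; lra.
  exact: fnorm_ge0.
have r3 : fnorm (r k.+1) <= fnorm (r k) / 3.
  exact: linear_step e5 c7 (gr k r300) Bs.
have r300' : fnorm (r k.+1) <= 1 / 300 by lra.
have yc : fnorm (g k.+1 - g k - (r k.+1 - r k)) <= c k * fnorm (r k.+1 - r k).
  rewrite /g -mulmxBr -s_r; apply: (grad_diff_close f_sc xs_min S_tr T_tr SS ST).
  - exact: near_dom.
  - exact: near_dom.
  - by lra.
  - exact: lexx.
  - by rewrite -/(r k.+1) -/(r k); lra.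
have gr' : fnorm (g k.+1 - r k.+1) <= c k * fnorm (r k.+1).
  apply: le_trans (gr _ r300') _; apply: ler_wpM2r; first exact: fnorm_ge0.
  by rewrite /c; lra.
have [|BT' [gm [gm0 gme] gm2]] :=
  upd_corrects (y := g k.+1 - g k) BT e5 (s_neq0 k) _ yc.
  by lra.
have BhE : Bh k.+1 = upd (Bh k) (r k.+1 - r k) (g k.+1 - g k).
  by rewrite -s_r /g -mulmxBr upd_equiv // -BE.
rewrite -BhE in BT' gme.
have c3 : c k.+1 <= c k / 3 by rewrite /c; lra.
have [p1 p2] := potential_decrease (fnorm_ge0 _) e5 e0 c0 c7 gm0 gm2 gme c3.
split; first by split => //; apply: le_trans p1 ec.
  rewrite -subr_ge0; apply: le_trans p2; apply: mulr_ge0; first by lra.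
  by apply: addr_ge0; exact: sqr_ge0.
have := superlinear_step c0 c7 (s_neq0 k) Bs r3 gr' yc.
move=> h; apply: le_trans h _; apply: ler_wpM2r; first exact: sqr_ge0.
exact: p2.
Qed.

Lemma qn_iterates k : fnorm (r k) <= 1 / 300 /\
  ((1 <= k)%N -> fnorm (r k) ^+ 2 <= (1 / k%:R) ^+ k * fnorm (r 0%N) ^+ 2).
Proof.
have invk j : inv j by elim: j => [|j /step[]]; first exact: inv0.
have c0 j : 0 <= c j by rewrite /c mulr_ge0 ?fnorm_ge0 //; lra.
have e0 j : 0 <= e j by exact: fnorm_ge0.
split; first by have [] := invk k.
apply: (superlinear_of_potential (a := fun k => fnorm (r k) ^+ 2) (P := P)).
- by move=> j; exact: sqr_ge0.
- by move=> j; have := sqr_ge0 (e j); have := c0 j; rewrite /P; lra.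
- have [_ rr ee] := invk 0%N; have := e0 0%N; have := c0 0%N.
  have : c 0%N <= 7 / 1000 by rewrite /c; lra.
  have h : e 0%N * e 0%N <= e 0%N * (1 / 5) by apply: ler_wpM2l => //; have := c0 0%N; lra.
  by rewrite /P; lra.
- by move=> j; have [_ + _] := step (invk j).
- by move=> j; have [_ _] := step (invk j).
Qed.

End Iteration.

(** * The theorem *)

Section Conclusion.
Context {R : realType} {d : nat}.
Implicit Types (A S T X : 'M[R]_d).

Lemma posdefmx_unit A : posdefmx A -> A \in unitmx.
Proof.
move=> [_ Apos]; apply: unitmx_inj => v Av; apply/eqP/negPn/negP => v0.
by have := Apos v v0; rewrite Av -frob_cv /frob mulmx0 mxtrace0 ltxx.
Qed.

Lemma posdefmx_inv A : posdefmx A -> posdefmx (invmx A).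
Proof.
move=> Ap; have Au := posdefmx_unit Ap; have [AT Apos] := Ap.
split=> [|v v0]; first by rewrite trmx_inv AT.
have w0 : invmx A *m v != 0.
  by apply: contraNneq v0 => w0; rewrite -[v](mulKVmx Au) w0 mulmx0.
by have := Apos _ w0; rewrite mulKVmx // dotcvC.
Qed.

Lemma sqrtmxP A : posdefmx A ->
  posdefmx (sqrtmx A) /\ sqrtmx A *m sqrtmx A = A.
Proof.
by move=> /sqrtmx_exists Sex; have := xgetPex 0 Sex.
Qed.

Lemma frob_sandwich S X : S^T = S ->
  frob (S *m X *m S) (S *m X *m S) = frob X ((S *m S) *m X *m (S *m S)).
Proof. by move=> ST; rewrite frob_mulr frob_mull ST !mulmxA. Qed.

(** The weighted norm depends on the weight only through its square, so the
    inverse of the root of the Hessian can stand for the root of the inverse. *)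
Lemma fnorm_sandwich S T X : S^T = S -> T^T = T -> S *m S = T *m T ->
  fnorm (S *m X *m S) = fnorm (T *m X *m T).
Proof. by move=> ST TT E; rewrite /fnorm !frob_sandwich // E. Qed.

Lemma powR_half (k : nat) (q : R) : 0 <= q -> (1 <= k)%N ->
  (q `^ (k%:R / 2)) ^+ 2 = q ^+ k.
Proof.
move=> q0 k1; rewrite -powR_mulrn ?powR_ge0 // -powRrM divfK ?pnatr_eq0 //.
by rewrite powR_mulrn.
Qed.

(** For [r] at most [1/300] the cubic term is below [2/100] of the square, and
    [13/25 <= 11/10 * (12/25)]. *)
Lemma function_ratio (F0 Fk r0 rk q : R) : 0 <= q -> 0 <= r0 -> 0 <= rk ->
  r0 <= 1 / 300 -> rk <= 1 / 300 -> rk ^+ 2 <= q * r0 ^+ 2 ->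
  `|F0 - r0 ^+ 2 / 2| <= 21 / 10 * r0 ^+ 3 ->
  `|Fk - rk ^+ 2 / 2| <= 21 / 10 * rk ^+ 3 ->
  Fk / F0 <= 11 / 10 * q.
Proof.
move=> q0 r00 rk0 r03 rk3 rq.
rewrite !ler_norml => /andP[F0l F0u] /andP[Fkl Fku].
have a0 : r0 ^+ 3 <= r0 ^+ 2 * (1 / 300).
  by rewrite exprSr; apply: ler_wpM2l; rewrite ?sqr_ge0.
have ak : rk ^+ 3 <= rk ^+ 2 * (1 / 300).
  by rewrite exprSr; apply: ler_wpM2l; rewrite ?sqr_ge0.
have F0h : 12 / 25 * r0 ^+ 2 <= F0 by lra.
have Fkh : Fk <= 13 / 25 * rk ^+ 2 by lra.
have F00 : 0 <= F0 by apply: le_trans F0h; apply: mulr_ge0; [lra|exact: sqr_ge0].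
move: F00; rewrite le_eqVlt => /predU1P[<-|F00].
  by rewrite invr0 mulr0; apply: mulr_ge0 => //; lra.
rewrite ler_pdivrMr //; have h := ler_wpM2l q0 F0h.
by lra.
Qed.

Lemma norm_ratio (r0 rk : R) (k : nat) : 0 <= r0 -> 0 <= rk -> (1 <= k)%N ->
  rk ^+ 2 <= (1 / k%:R) ^+ k * r0 ^+ 2 ->
  rk / r0 <= (1 / k%:R) `^ (k%:R / 2).
Proof.
move=> r00 rk0 k1 h; move: r00; rewrite le_eqVlt => /predU1P[<-|r00].
  by rewrite invr0 mulr0 powR_ge0.
have k0 : 0 <= 1 / k%:R :> R by exact: divr_ge0.
rewrite -ler_sqr ?nnegrE ?powR_ge0 ?divr_ge0 ?(ltW r00) //.
by rewrite powR_half // expr_div_n ler_pdivrMr // exprn_gt0.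
Qed.

Lemma superlinear_convergence (D : set 'cV[R]_d) (f : 'cV[R]_d -> R) xs
    (upd : 'M[R]_d -> 'cV[R]_d -> 'cV[R]_d -> 'M[R]_d)
    (x : nat -> 'cV[R]_d) (B : nat -> 'M[R]_d) :
  self_concordant D f -> minimizer D f xs ->
  self_correcting upd -> congruence_equivariant upd ->
  posdefmx (B 0%N) -> quasi_newton upd f x B ->
  (forall k : nat, x k.+1 - x k != 0) ->
  norm2 (sqrtmx (hess f xs) *m (x 0%N - xs)) <= 1 / 300 ->
  normF (sqrtmx (invmx (hess f xs)) *m (B 0%N - hess f xs)
           *m sqrtmx (invmx (hess f xs))) <= 1 / 7 ->
  forall k : nat, (1 <= k)%N ->
    [/\ x k \in D,
        norm2 (sqrtmx (hess f xs) *m (x k - xs))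
          / norm2 (sqrtmx (hess f xs) *m (x 0%N - xs))
          <= (1 / k%:R) `^ (k%:R / 2)
      & (f (x k) - f xs) / (f (x 0%N) - f xs) <= 11 / 10 * (1 / k%:R) ^+ k].
Proof.
move=> f_sc xs_min upd_c upd_e [B0T _] qn steps.
have [xsD _] := xs_min; have Hp := sc_hess f_sc xsD.
have Hu := posdefmx_unit Hp.
have [[ST _] SS] := sqrtmxP Hp.
have [[VT _] VV] := sqrtmxP (posdefmx_inv Hp).
move: (sqrtmx (hess f xs)) (sqrtmx (invmx (hess f xs))) ST SS VT VV.
move=> S V ST SS VT VV; rewrite -!fnorm_cv -fnorm_sq => x0c B0c k k1.
have Su : S \in unitmx by move: Hu; rewrite -SS unitmx_mul => /andP[].
have TT : (invmx S)^T = invmx S by rewrite trmx_inv ST.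
have SiS : S *m invmx S = 1%:M by exact: mulmxV.
rewrite (fnorm_sandwich (T := invmx S)) // in B0c; last first.
  rewrite VV -[RHS](mulmxK Hu) -SS -!mulmxA (mulmxA _ S) mulVmx // mul1mx.
  by rewrite mulmxA mulVmx // mul1mx.
have it := qn_iterates f_sc xs_min ST TT SS SiS upd_c upd_e B0T qn steps x0c B0c.
have close j : fnorm (S *m (x j - xs)) <= 1 / 100.
  by have [h _] := it j; lra.
have dom j : D (x j) := local_ball_dom f_sc xs_min ST TT SS SiS (close j).
have fc j := f_close f_sc xs_min ST TT SS SiS (dom j) (close j).
have [rk /(_ k1) rate] := it k.
rewrite -!fnorm_cv; split; first exact/mem_set/dom.
- exact: norm_ratio (fnorm_ge0 _) (fnorm_ge0 _) k1 rate.
- have q0 : 0 <= (1 / k%:R) ^+ k :> R by apply: exprn_ge0; exact: divr_ge0.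
  exact: function_ratio q0 (fnorm_ge0 _) (fnorm_ge0 _) x0c rk rate (fc 0%N) (fc k).
Qed.

End Conclusion.

Unset Implicit Arguments.

Theorem corollary5p5 (R : realType) (d : nat) (D : set 'cV[R]_d)
    (f : 'cV[R]_d -> R) (xs : 'cV[R]_d)
    (f_sc : self_concordant D f) (xs_min : minimizer D f xs) :
  (forall (x : nat -> 'cV[R]_d) (B : nat -> 'M[R]_d),
     x 0%N \in D -> posdefmx (B 0%N) ->
     quasi_newton dfp_update f x B ->
     (forall k : nat, x k.+1 - x k != 0) ->
     norm2 (sqrtmx (hess f xs) *m (x 0%N - xs)) <= 1 / 720 ->
     normF (sqrtmx (invmx (hess f xs)) *m (B 0%N - hess f xs)
              *m sqrtmx (invmx (hess f xs))) <= 1 / 7 ->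
     forall k : nat, (1 <= k)%N ->
       [/\ x k \in D,
           norm2 (sqrtmx (hess f xs) *m (x k - xs))
             / norm2 (sqrtmx (hess f xs) *m (x 0%N - xs))
             <= (1 / k%:R) `^ (k%:R / 2)
         & (f (x k) - f xs) / (f (x 0%N) - f xs)
             <= 11 / 10 * (1 / k%:R) ^+ k])
  /\
  (forall (x : nat -> 'cV[R]_d) (B : nat -> 'M[R]_d),
     x 0%N \in D -> posdefmx (B 0%N) ->
     quasi_newton bfgs_update f x B ->
     (forall k : nat, x k.+1 - x k != 0) ->
     norm2 (sqrtmx (hess f xs) *m (x 0%N - xs)) <= 1 / 300 ->
     normF (sqrtmx (invmx (hess f xs)) *m (B 0%N - hess f xs)
              *m sqrtmx (invmx (hess f xs))) <= 1 / 7 ->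
     forall k : nat, (1 <= k)%N ->
       [/\ x k \in D,
           norm2 (sqrtmx (hess f xs) *m (x k - xs))
             / norm2 (sqrtmx (hess f xs) *m (x 0%N - xs))
             <= (1 / k%:R) `^ (k%:R / 2)
         & (f (x k) - f xs) / (f (x 0%N) - f xs)
             <= 11 / 10 * (1 / k%:R) ^+ k]).
Proof.
split=> x B _ B0 qn steps x0c B0c.
- apply: superlinear_convergence qn steps _ B0c => //.
  + exact: dfp_self_correcting.
  + exact: dfp_update_equivariant.
  + by apply: le_trans x0c _; lra.
- apply: superlinear_convergence qn steps x0c B0c => //.
  + exact: bfgs_self_correcting.
  + exact: bfgs_update_equivariant.
Qed.
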